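(* Let $K$ be a knot in $S^3$ with group $\pi$, let $\alpha\in\mathbb{C}^*$ be a root of the Alexander polynomial $\Delta_K(t)$, and let $\tau_\alpha\cong\bigoplus_{i=1}^{k_\alpha}\Lambda/(t-\alpha)^{q_i}$ (with $q_i\geq 1$) be the $(t-\alpha)$-primary part of the complex Alexander module $H_1(X^\infty,\mathbb{C})$. Let $n\geq 2$. Then the space of $1$-coboundaries $B^1(\pi,\mathbb{C}_\alpha)$ is strictly contained in $C_n$ if and only if there exists $1\leq i\leq k_\alpha$ such that $q_i\geq n-1$. Moreover, $$\dim_{\mathbb{C}} C_n = 1+\operatorname{card}\{1\leq i\leq k_\alpha \mid q_i\geq n-1\}.$$
   Context: Let $K$ be a knot in $S^3$, $X=\overline{S^3\setminus V(K)}$ its exterior ($V(K)$ a tubular neighbourhood of $K$), $\pi=\pi_1(X)$, $\mu\in\pi$ a meridian, $\pi'=[\pi,\pi]$, $\pi''=[\pi',\pi']$. Let $T=\langle t\mid -\rangle\cong\pi/\pi'$ be infinite cyclic, generated by the image $t$ of $\mu$, and for $\gamma\in\pi$ let $|\gamma|\in\mathbb{Z}$ be the image of $\gamma$ under $\pi\to\pi/\pi'\cong\mathbb{Z}$, so $|\mu|=1$. Put $\Lambda=\mathbb{C}[t,t^{-1}]$ and let $X^\infty$ be the infinite cyclic cover of $X$ corresponding to $\pi'$. The complex Alexander module $H_1(X^\infty,\mathbb{C})\cong\pi'/\pi''\otimes_{\mathbb{Z}}\mathbb{C}$ is a $\Lambda$-module by $t\cdot(y\otimes z)=(\mu y\mu^{-1})\otimes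 z$; it is a finitely generated torsion $\Lambda$-module, its order ideal is principal, and any generator of this ideal is an Alexander polynomial $\Delta_K(t)$. It decomposes as $\bigoplus_{\Delta_K(\beta)=0}\tau_\beta$, where $\tau_\beta\cong\bigoplus_{i=1}^{k_\beta}\Lambda/(t-\beta)^{q_i}$ with $q_i\in\mathbb{N}^*$ (depending on $\beta$); $k_\beta$ is the number of cyclic summands of $\tau_\beta$. For $\alpha\in\mathbb{C}^*$, $\mathbb{C}_\alpha$ is the $\pi$-module $\mathbb{C}$ with action $\gamma\cdot z=\alpha^{|\gamma|}z$. $C^1(\pi,\mathbb{C}_\alpha)$ is the space of all functions $\pi\to\mathbb{C}$; $Z^1(\pi,\mathbb{C}_\alpha)$ is the space of $f$ with $f(\gamma_1\gamma_2)=f(\gamma_1)+\alpha^{|\gamma_1|}f(\gamma_2)$ for all $\gamma_1,\gamma_2\in\pi$; $B^1(\pi,\mathbb{C}_\alpha)$ is the space of functions $\gamma\mapsto(\alpha^{|\gamma|}-1)a$, $a\in\mathbb{C}$. $G_n$ is the group of invertible upper triangular $n\times n$ complex matrices. For $m\geq1$, $\phi_m:\pi\to GL(m,\mathbb{C})$ is the homomorphism factoring through $\pi/\pi'$ with $\phi_m(\mu)=I_m+\mathcal{N}_m$, where $\mathcal{N}_m$ has $1$'s on the first superdiagonal and $0$ elsewhere. For $V=(v_1,\ldots,v_{n-1})\in (C^1(\pi,\mathbb{C}_\alpha))^{n-1}$ define the map $\rho_n^V:\pi\to G_n$ by $$\rho_n^V(\gamma)=\begin{pmatrix}\alpha^{|\gamma|}&V(\gamma)\\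 0&\phi_{n-1}(\gamma)\end{pmatrix},$$ where $V(\gamma)$ is the row vector $(v_1(\gamma),\ldots,v_{n-1}(\gamma))$. For $n\geq 2$ set $$C_n=\{U\in Z^1(\pi,\mathbb{C}_\alpha)\mid \exists\,(v_2,\ldots,v_{n-1})\in (C^1(\pi,\mathbb{C}_\alpha))^{n-2}\text{ such that }\rho_n^{(U,v_2,\ldots,v_{n-1})}\text{ is a group homomorphism}\};$$ it is a complex vector subspace of $Z^1(\pi,\mathbb{C}_\alpha)$ containing $B^1(\pi,\mathbb{C}_\alpha)$. *)

(* Defs.v *)
From HB Require Import structures.
From mathcomp Require Import all_boot all_order all_algebra.
From mathcomp Require Import generic_quotient ring_quotient fraction.
From mathcomp Require Import all_classical all_reals all_analysis.
From mathcomp.multinomials Require Import freeg.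
From mathcomp Require Import lra.
Set Implicit Arguments.
Unset Strict Implicit.
Unset Printing Implicit Defensive.
Import Order.TTheory GRing.Theory Num.Theory.
Import numFieldNormedType.Exports.
Local Open Scope classical_set_scope.
Local Open Scope ring_scope.

Section Continuity.
Context {T U W : topologicalType}.

Lemma within_comp (A : set T) (B : set U) (f : T -> U) (g : U -> W) :
  {within A, continuous f} -> {within B, continuous g} ->
  (forall x, A x -> B (f x)) -> {within A, continuous (g \o f)}.
Proof.
move=> /subspace_continuousP cf /subspace_continuousP cg AB.
apply/subspace_continuousP => x Ax.
apply: cvg_trans (cg _ (AB _ Ax)) => N /= gN.
have := cf x Ax _ gN; rewrite /nbhs /= /within /= => h.
by near=> y => Ay; apply: (near h y) => //; exact: AB.
Unshelve. all: by end_near. Qed.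

Lemma continuous_pair (f : T -> U) (g : T -> W) :
  continuous f -> continuous g -> continuous (fun z => (f z, g z)).
Proof. by move=> cf cg z; apply: cvg_pair; [exact: cf|exact: cg]. Qed.

Lemma within_glue (R : realType) (D : set T) (c : T -> R) (a : R)
    (f g : T -> U) : closed D -> continuous c ->
  {within D `&` [set x | c x <= a], continuous f} ->
  {within D `&` [set x | a <= c x], continuous g} ->
  (forall x, D x -> c x = a -> f x = g x) ->
  {within D, continuous (fun x => if c x <= a then f x else g x)}.
Proof.
move=> cD cc cf cg fg.
have cl1 : closed [set x | c x <= a].
  by apply: (closed_comp (fun x _ => cc x) (@closed_le R a)).
have cl2 : closed [set x | a <= c x].
  by apply: (closed_comp (fun x _ => cc x) (@closed_ge R a)).
have -> : D = (D `&` [set x | c x <= a]) `|` (D `&` [set x | a <= c x]).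
  apply/seteqP; split=> [x Dx|x [[]|[]]//].
  by have [?|/ltW ?] := leP (c x) a; [left|right].
apply: withinU_continuous; [exact: closedI|exact: closedI| |].
- apply: subspace_eq_continuous cf => x /set_mem[/= _ xa]; by rewrite /from_subspace xa.
- refine (@subspace_eq_continuous _ _ _ g _ _ cg) => x /set_mem[/= Dx ax].
  by rewrite /from_subspace; case: leP => // xa; rewrite fg //; apply/eqP; rewrite eq_le xa ax.
Qed.

End Continuity.

Section FundamentalGroup.
Context {R : realType} {V : topologicalType} (X : set V) (x0 : X).

Local Notation I := (`[0%R, 1%R]%classic : set R).

(* Only the values on [0, 1] of the functions loop_fun and, in homotopic, H are
   relevant; homotopies are rel endpoints. *)
Record loop := Loop {
  loop_fun :> R -> V;
  loop_continuous : {within I, continuous loop_fun};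
  loop_in : forall s, I s -> X (loop_fun s);
  loop_0 : loop_fun 0 = \val x0;
  loop_1 : loop_fun 1 = \val x0 }.

HB.instance Definition _ := gen_eqMixin loop.
HB.instance Definition _ := gen_choiceMixin loop.

Definition homotopic (p q : loop) : Prop :=
  exists H : R * R -> V, [/\ {within I `*` I, continuous H},
    forall z, (I `*` I) z -> X (H z),
    forall s, I s -> H (0, s) = p s /\ H (1, s) = q s
  & forall u, I u -> H (u, 0) = \val x0 /\ H (u, 1) = \val x0].

Let I0 : I (0 : R). Proof. by rewrite /= in_itv /= lexx ler01. Qed.
Let I1 : I (1 : R). Proof. by rewrite /= in_itv /= lexx ler01. Qed.
Let IP (s : R) : I s <-> (0 <= s <= 1).
Proof. by rewrite /= in_itv. Qed.
Let cI : closed I. Proof. exact: itv_closed. Qed.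
Let fst_cont : continuous (@fst R R). Proof. by move=> z; exact: cvg_fst. Qed.
Let snd_cont : continuous (@snd R R). Proof. by move=> z; exact: cvg_snd. Qed.
Let cII : closed (I `*` I).
Proof.
have -> : I `*` I = (fst @^-1` I) `&` (snd @^-1` I) by [].
by apply: closedI; apply: closed_comp => // z _.
Qed.

Let within_cont (T U : topologicalType) (A : set T) (f : T -> U) :
  continuous f -> {within A, continuous f}.
Proof. exact: continuous_subspaceT. Qed.

Lemma homotopic_refl p : homotopic p p.
Proof.
exists (p \o snd); split.
- apply: (within_comp (B := I)); [|exact: loop_continuous|by move=> x []].
  exact: within_cont.
- by move=> z [_ ?]; exact: loop_in.
- by [].
- by move=> u _ /=; rewrite loop_0 loop_1.
Qed.

Lemma homotopic_sym p q : homotopic p q -> homotopic q p.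
Proof.
case=> H [Hc HX H01 Hx]; exists (H \o (fun z => (1 - z.1, z.2))).
have aux u : I u -> I (1 - u) by rewrite /= ?in_itv /= => ?; lra.
split.
- apply: (within_comp (B := I `*` I)) => //; last first.
    by move=> z [? ?]; split=> //=; exact: aux.
  apply: within_cont; apply: continuous_pair; last exact: snd_cont.
  by move=> z; apply: cvgB; [exact: cvg_cst|exact: fst_cont].
- by move=> z [? ?]; apply: HX; split=> //=; exact: aux.
- by move=> s Is /=; rewrite subr0 subrr; split; apply H01.
- by move=> u Iu /=; exact/Hx/aux.
Qed.

Lemma homotopic_trans q p r :
  homotopic p q -> homotopic q r -> homotopic p r.
Proof.
case=> H [Hc HX H01 Hx] [K [Kc KX K01 Kx]].
exists (fun z => if z.1 <= 2^-1 then (H \o (fun z => (2 * z.1, z.2))) z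
  else (K \o (fun z => (2 * z.1 - 1, z.2))) z).
have c2 : continuous (fun z : R * R => 2 * z.1).
  by move=> z; apply: cvgMl_tmp; exact: fst_cont.
split.
- apply: within_glue => //.
  + apply: (within_comp (B := I `*` I)) => //; last first.
      move=> [u s] /= [[/= Iu Is] u2]; split=> //=; move: Iu; rewrite /= ?in_itv /=.
      by move=> ?; lra.
    apply: within_cont; apply: continuous_pair; [exact: c2|exact: snd_cont].
  + apply: (within_comp (B := I `*` I)) => //; last first.
      move=> [u s] /= [[/= Iu Is] u2]; split=> //=; move: Iu; rewrite /= ?in_itv /=.
      by move=> ?; lra.
    apply: within_cont; apply: continuous_pair; last exact: snd_cont.
    by move=> z; apply: cvgB; [exact: c2|exact: cvg_cst].
  + move=> [u s] /= [_ Is] ->; rewrite divff ?subrr //.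
    by rewrite (H01 _ Is).2 (K01 _ Is).1.
- move=> [u s] [/= Iu Is]; case: ifP => u2 /=.
    by apply: HX; split=> //=; move: Iu u2; rewrite /= ?in_itv /= => ? ?; lra.
  apply: KX; split=> //=; move: Iu (negbT u2); rewrite /= ?in_itv /= -ltNge.
  by move=> ? ?; lra.
- move=> s Is /=; rewrite invr_ge0 ler0n mulr0 (H01 _ Is).1; split=> //.
  case: leP => [?|_]; first by exfalso; lra.
  by rewrite (_ : 2 * 1 - 1 = 1) ?(K01 _ Is).2 //; lra.
- move=> u Iu /=; case: ifP => u2.
    by apply: Hx; move: Iu u2; rewrite /= ?in_itv /= => ? ?; lra.
  by apply: Kx; move: Iu (negbT u2); rewrite /= ?in_itv /= -ltNge => ? ?; lra.
Qed.

Definition homotopicb (p q : loop) : bool := `[< homotopic p q >].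

Lemma homotopicb_equiv : equiv_class_of homotopicb.
Proof.
split=> [p|p q|q p r].
- exact/asboolP/homotopic_refl.
- by apply/idP/idP => /asboolP /homotopic_sym /asboolP.
- by move=> /asboolP pq /asboolP qr; exact/asboolP/(homotopic_trans pq qr).
Qed.

Canonical homotopicb_equiv_rel := EquivRelPack homotopicb_equiv.
Canonical homotopicb_encModRel := defaultEncModRel homotopicb.

Section Reparam.
Variables (p : loop) (phi : R -> R).
Hypotheses (phic : {within I, continuous phi}) (phiI : forall s, I s -> I (phi s)).
Hypotheses (phi0 : p (phi 0) = \val x0) (phi1 : p (phi 1) = \val x0).

Lemma reparam_cont : {within I, continuous (p \o phi)}.
Proof. by apply: (within_comp (B := I)) => //; exact: loop_continuous. Qed.

Lemma reparam_in s : I s -> X ((p \o phi) s).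
Proof. by move=> Is; exact/loop_in/phiI. Qed.

Definition reparam := Loop reparam_cont reparam_in phi0 phi1.
End Reparam.

Lemma reparam_homotopic (p q r : loop) (phi psi : R -> R) :
  {within I, continuous phi} -> (forall s, I s -> I (phi s)) ->
  {within I, continuous psi} -> (forall s, I s -> I (psi s)) ->
  phi 0 = psi 0 -> phi 1 = psi 1 ->
  (forall s, I s -> q s = p (phi s)) -> (forall s, I s -> r s = p (psi s)) ->
  homotopic q r.
Proof.
move=> phic phiI psic psiI e0 e1 qE rE.
pose G (z : R * R) := (1 - z.1) * phi z.2 + z.1 * psi z.2.
have GI z : (I `*` I) z -> I (G z).
  case: z => u s [/= Iu Is]; have := phiI _ Is; have := psiI _ Is.
  by move: Iu; rewrite /= ?in_itv /= /G /= => ? ? ?; apply/andP; split; nra.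
have csnd (f : R -> R) : {within I, continuous f} ->
    {within I `*` I, continuous (f \o snd)}.
  move=> cf; apply: (within_comp (B := I)) => //; last by move=> z [].
  exact: within_cont.
exists (p \o G); split.
- apply: (within_comp (B := I)) => //; last exact: loop_continuous.
  apply/subspace_continuousP => z Iz.
  have /subspace_continuousP/(_ z Iz) h1 := csnd _ phic.
  have /subspace_continuousP/(_ z Iz) h2 := csnd _ psic.
  have h3 : (fun z : R * R => z.1) @ within (I `*` I) (nbhs z) --> z.1.
    by apply: cvg_within_filter; exact: fst_cont.
  apply: cvgD; apply: cvgM => //.
  by apply: cvgB => //; exact: cvg_cst.
- by move=> z Iz; exact/loop_in/GI.
- move=> s Is; rewrite /G /= subr0 subrr !mul0r !mul1r addr0 add0r.
  by rewrite qE ?rE.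
- move=> u Iu; rewrite /G /= -e0 -e1 -!mulrDl !subrK !mul1r.
  by rewrite -!qE // loop_0 loop_1.
Qed.

Definition cst_loop : loop.
Proof.
apply: (@Loop (fun=> \val x0)) => //; last by move=> s _; exact: set_valP.
by apply: within_cont; exact: cst_continuous.
Defined.

Lemma rev_subproof (p : loop) :
  [/\ {within I, continuous (fun s : R => p (1 - s))},
   forall s, I s -> X (p (1 - s)), p (1 - 0) = \val x0 & p (1 - 1) = \val x0].
Proof.
have aux (s : R) : I s -> I (1 - s) by rewrite /= ?in_itv /= => ?; lra.
split; rewrite ?subr0 ?subrr ?loop_0 ?loop_1 //.
- apply: (within_comp (B := I)) => //; last exact: loop_continuous.
  by apply: within_cont => s; apply: cvgB; [exact: cvg_cst|exact: cvg_id].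
- by move=> s /aux; exact: loop_in.
Qed.

Definition rev_loop (p : loop) : loop :=
  let: And4 c i e0 e1 := rev_subproof p in Loop c i e0 e1.

Definition concat_fun (p q : R -> V) (s : R) : V :=
  if s <= 2^-1 then p (2 * s) else q (2 * s - 1).

Let c2 : continuous (fun s : R => 2 * s).
Proof. by move=> s; apply: cvgMl_tmp; exact: cvg_id. Qed.
Let c21 : continuous (fun s : R => 2 * s - 1).
Proof. by move=> s; apply: cvgB; [exact: c2|exact: cvg_cst]. Qed.

Lemma concat_continuous (p q : loop) :
  {within I, continuous (concat_fun p q)}.
Proof.
apply: (@within_glue _ _ R I id 2^-1 (p \o (fun s => 2 * s))
  (q \o (fun s => 2 * s - 1))) => //.
- by move=> ?; exact: cvg_id.
- apply: (within_comp (B := I)) => //; first exact: within_cont.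
    exact: loop_continuous.
  by move=> s [/IP] /= ? ?; apply/IP; lra.
- apply: (within_comp (B := I)) => //; first exact: within_cont.
    exact: loop_continuous.
  by move=> s [/IP] /= ? ?; apply/IP; lra.
- by move=> s /= _ ->; rewrite divff // subrr loop_0 loop_1.
Qed.

Lemma concat_in (p q : loop) s : I s -> X (concat_fun p q s).
Proof.
rewrite IP /concat_fun => ?; case: ifP => s2.
  by apply: loop_in; apply/IP; lra.
by apply: loop_in; move/negbT: s2; rewrite IP -ltNge => ?; lra.
Qed.

Lemma concat_0 (p q : loop) : concat_fun p q 0 = \val x0.
Proof. by rewrite /concat_fun invr_ge0 ler0n mulr0 loop_0. Qed.

Lemma concat_1 (p q : loop) : concat_fun p q 1 = \val x0.
Proof.
rewrite /concat_fun; case: leP => [?|_]; first by exfalso; lra.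
by rewrite (_ : 2 * 1 - 1 = 1) ?loop_1 //; lra.
Qed.

Definition concat (p q : loop) : loop :=
  Loop (@concat_continuous p q) (@concat_in p q) (concat_0 p q) (concat_1 p q).

Lemma concat_homotopic p p' q q' :
  homotopic p p' -> homotopic q q' -> homotopic (concat p q) (concat p' q').
Proof.
case=> H [Hc HX H01 Hx] [K [Kc KX K01 Kx]].
have h1 s : I s -> s <= 2^-1 -> I (2 * s) by rewrite /= ?in_itv /= => ? ?; lra.
have h2 s : I s -> 2^-1 <= s -> I (2 * s - 1) by rewrite /= ?in_itv /= => ? ?; lra.
exists (fun z => if z.2 <= 2^-1 then (H \o (fun z => (z.1, 2 * z.2))) z
  else (K \o (fun z => (z.1, 2 * z.2 - 1))) z); split.
- apply: within_glue => //.
  + apply: (within_comp (B := I `*` I)) => //; last first.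
      by move=> [u s] /= [[/= Iu Is] u2]; split=> //=; exact: h1.
    apply: within_cont; apply: continuous_pair; first exact: fst_cont.
    by move=> z; apply: cvgMl_tmp; exact: snd_cont.
  + apply: (within_comp (B := I `*` I)) => //; last first.
      by move=> [u s] /= [[/= Iu Is] u2]; split=> //=; exact: h2.
    apply: within_cont; apply: continuous_pair; first exact: fst_cont.
    by move=> z; apply: cvgB; [apply: cvgMl_tmp; exact: snd_cont|exact: cvg_cst].
  + move=> [u s] /= [Iu _] ->; rewrite divff ?subrr //.
    by rewrite (Hx _ Iu).2 (Kx _ Iu).1.
- move=> [u s] [/= Iu Is]; case: leP => u2 /=.
    by apply: HX; split=> //=; exact: h1.
  by apply: KX; split=> //=; apply: h2 => //; exact: ltW.
- move=> s Is /=; rewrite /concat_fun; case: leP => u2.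
    by apply: H01; exact: h1.
  by apply: K01; apply: h2 => //; exact: ltW.
- move=> u Iu /=; rewrite invr_ge0 ler0n mulr0 (Hx _ Iu).1; split=> //.
  case: leP => [?|_]; first by exfalso; lra.
  by rewrite (_ : 2 * 1 - 1 = 1) ?(Kx _ Iu).2 //; lra.
Qed.

Lemma rev_homotopic p p' :
  homotopic p p' -> homotopic (rev_loop p) (rev_loop p').
Proof.
case=> H [Hc HX H01 Hx]; exists (H \o (fun z => (z.1, 1 - z.2))).
have aux u : I u -> I (1 - u) by rewrite /= ?in_itv /= => ?; lra.
split.
- apply: (within_comp (B := I `*` I)) => //; last first.
    by move=> z [? ?]; split=> //=; exact: aux.
  apply: within_cont; apply: continuous_pair; first exact: fst_cont.
  by move=> z; apply: cvgB; [exact: cvg_cst|exact: snd_cont].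
- by move=> z [? ?]; apply: HX; split=> //=; exact: aux.
- move=> s Is /=; rewrite /rev_loop; case: rev_subproof => ????.
  by case: rev_subproof => ???? /=; apply: H01; exact: aux.
- by move=> u Iu /=; rewrite subr0 subrr; split; apply Hx.
Qed.

Let if_cont (f g : R -> R) (a : R) : continuous f -> continuous g ->
  f a = g a -> {within I, continuous (fun s => if s <= a then f s else g s)}.
Proof.
move=> cf cg fg.
apply: (@within_glue _ _ R I id a f g) => //; [by move=> ?; exact: cvg_id|idtac|idtac|]; first exact: within_cont.
  exact: within_cont.
by move=> x _ ->.
Qed.

Let id_within : {within I, continuous (id : R -> R)}.
Proof. by apply: within_cont => ?; exact: cvg_id. Qed.

Lemma concat_cst_l p : homotopic (concat cst_loop p) p.
Proof.
apply: (@reparam_homotopic p _ _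
  (fun s => if s <= 2^-1 then 0 else 2 * s - 1) id) => //=.
- apply: if_cont => //; first by move=> ?; exact: cvg_cst.
  by rewrite divff ?subrr.
- by move=> s; rewrite /= ?in_itv /= => ?; case: (leP s) => ?; lra.
- by case: leP => // ?; lra.
- by case: leP => // ?; lra.
- by move=> s Is; rewrite /concat_fun; case: leP; rewrite ?loop_0.
Qed.

Lemma concat_cst_r p : homotopic (concat p cst_loop) p.
Proof.
apply: (@reparam_homotopic p _ _
  (fun s => if s <= 2^-1 then 2 * s else 1) id) => //=.
- apply: if_cont => //; first by move=> ?; exact: cvg_cst.
  by rewrite divff.
- by move=> s; rewrite /= ?in_itv /= => ?; case: (leP s) => ?; lra.
- by case: leP => // ?; lra.
- by case: leP => // ?; lra.
- by move=> s Is; rewrite /concat_fun; case: leP; rewrite ?loop_1.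
Qed.

Lemma concat_assoc p q r :
  homotopic (concat p (concat q r)) (concat (concat p q) r).
Proof.
pose phi (s : R) := if s <= 2^-1 then s / 2 else
  (if s <= 2^-1 + 2^-1 / 2 then s - 2^-1 / 2 else 2 * s - 1).
have ch : continuous (fun s : R => s / 2).
  by move=> s; apply: cvgMr_tmp; exact: cvg_id.
have cq : continuous (fun s : R => s - 2^-1 / 2).
  by move=> s; apply: cvgB; [exact: cvg_id|exact: cvg_cst].
apply: (@reparam_homotopic (concat (concat p q) r) _ _ phi id) => //=.
- apply: (@within_glue _ _ R I id) => //.
  + by move=> ?; exact: cvg_id.
  + exact: within_cont.
  + apply: (@within_glue _ _ R _ id) => //.
    * apply: closedI => //; exact: closed_ge.
    * by move=> ?; exact: cvg_id.
    * exact: within_cont.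
    * exact: within_cont.
    * by move=> s _ /= ->; lra.
  + move=> s _ /= ->; case: leP => ?; lra.
- move=> s; rewrite /phi /= ?in_itv /= => ?; case: (leP s) => ?; first lra.
  by case: (leP s) => ?; lra.
- by rewrite /phi; case: leP => ?; [lra|case: leP => ?; lra].
- by rewrite /phi; case: leP => ?; [lra|case: leP => ?; lra].
- move=> s /IP Is; rewrite /phi /concat_fun; case: (leP s) => s1.
    have -> : s / 2 <= 2^-1 by lra.
    have -> : 2 * (s / 2) <= 2^-1 by lra.
    by congr (p _); lra.
  case: (leP s (2^-1 + _)) => s2.
    have -> : s - 2^-1 / 2 <= 2^-1 by lra.
    have -> : (2 * (s - 2^-1 / 2) <= 2^-1) = false.
      by apply/negbTE; rewrite -ltNge; lra.
    have -> : 2 * s - 1 <= 2^-1 by lra.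
    by congr (q _); lra.
  have -> : (2 * s - 1 <= 2^-1) = false.
    by apply/negbTE; rewrite -ltNge; lra.
  by [].
Qed.

Lemma concat_rev_r p : homotopic (concat p (rev_loop p)) cst_loop.
Proof.
apply: (@reparam_homotopic p _ _
  (fun s => if s <= 2^-1 then 2 * s else 2 - 2 * s) (fun=> 0)) => //=.
- apply: if_cont => //; last by lra.
  by move=> s; apply: cvgB; [exact: cvg_cst|exact: c2].
- by move=> s; rewrite /= ?in_itv /= => ?; case: (leP s) => ?; lra.
- by apply: within_cont => ?; exact: cvg_cst.
- by case: leP => // ?; lra.
- by case: leP => // ?; lra.
- move=> s Is; rewrite /concat_fun /rev_loop; case: rev_subproof => ???? /=.
  by case: leP => // _; congr (p _); lra.
- by move=> s _; rewrite loop_0.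
Qed.

Lemma rev_rev p : homotopic (rev_loop (rev_loop p)) p.
Proof.
apply: (@reparam_homotopic p _ _ id id) => // s _.
rewrite {1}/rev_loop; case: rev_subproof => ???? /=.
by rewrite /rev_loop; case: rev_subproof => ???? /=; rewrite subKr.
Qed.

Lemma concat_rev_l p : homotopic (concat (rev_loop p) p) cst_loop.
Proof.
apply: homotopic_trans (concat_rev_r (rev_loop p)).
apply: concat_homotopic; first exact: homotopic_refl.
exact/homotopic_sym/rev_rev.
Qed.

Definition fundamental_group := {eq_quot homotopicb}%qT.
HB.instance Definition _ := EqQuotient.on fundamental_group.
HB.instance Definition _ := Choice.on fundamental_group.

Definition loop_class (p : loop) : fundamental_group :=
  (\pi_fundamental_group p)%qT.

Lemma loop_classP p q : loop_class p = loop_class q <-> homotopic p q.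
Proof.
split; last by move=> ?; apply/eqmodP/asboolP.
by move/eqmodP => /asboolP.
Qed.

Lemma loop_class_surj (g : fundamental_group) : exists p, g = loop_class p.
Proof. by exists (repr g); rewrite /loop_class reprK. Qed.

Definition pi1_one := loop_class cst_loop.
Definition pi1_inv (g : fundamental_group) := loop_class (rev_loop (repr g)).
(* First g, then h. *)
Definition pi1_mul (g h : fundamental_group) :=
  loop_class (concat (repr g) (repr h)).

Lemma repr_class p : homotopic (repr (loop_class p)) p.
Proof. by apply/loop_classP; rewrite /loop_class reprK. Qed.

Lemma pi1_mulE p q :
  pi1_mul (loop_class p) (loop_class q) = loop_class (concat p q).
Proof. by apply/loop_classP/concat_homotopic; exact: repr_class. Qed.

Lemma pi1_invE p : pi1_inv (loop_class p) = loop_class (rev_loop p).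
Proof. by apply/loop_classP/rev_homotopic; exact: repr_class. Qed.

Fact pi1_mulA : associative pi1_mul.
Proof.
move=> g h k; have [[p ->] [q ->] [r ->]] :=
  And3 (loop_class_surj g) (loop_class_surj h) (loop_class_surj k).
by rewrite !pi1_mulE; apply/loop_classP/concat_assoc.
Qed.

Fact pi1_mul1g : left_id pi1_one pi1_mul.
Proof.
move=> g; have [p ->] := loop_class_surj g.
by rewrite pi1_mulE; apply/loop_classP/concat_cst_l.
Qed.

Fact pi1_mulg1 : right_id pi1_one pi1_mul.
Proof.
move=> g; have [p ->] := loop_class_surj g.
by rewrite pi1_mulE; apply/loop_classP/concat_cst_r.
Qed.

Fact pi1_mulVg : left_inverse pi1_one pi1_inv pi1_mul.
Proof.
move=> g; have [p ->] := loop_class_surj g.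
by rewrite pi1_invE pi1_mulE; apply/loop_classP/concat_rev_l.
Qed.

Fact pi1_mulgV : right_inverse pi1_one pi1_inv pi1_mul.
Proof.
move=> g; have [p ->] := loop_class_surj g.
by rewrite pi1_invE pi1_mulE; apply/loop_classP/concat_rev_r.
Qed.

HB.instance Definition _ := isGroup.Build fundamental_group
  pi1_mulA pi1_mul1g pi1_mulg1 pi1_mulVg pi1_mulgV.

End FundamentalGroup.
Section GeneratedSubmodule.
Context {A : nzRingType} {M : lmodType A} (G : set M).

Inductive generated : M -> Prop :=
| generated0 : generated 0
| generatedD a x y : G x -> generated y -> generated (a *: x + y).

Definition generated_submodule : {pred M} := fun x => `[< generated x >].

Fact generated_closed : subsemimod_closed generated_submodule.
Proof.
have genD x y : generated x -> generated y -> generated (x + y).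
  elim=> [|a {}x z Gx _ IH] gy; first by rewrite add0r.
  by rewrite -addrA; apply: generatedD => //; exact: IH.
split=> [|a x /asboolP gx].
  split; first by apply/asboolP; exact: generated0.
  by move=> x y /asboolP gx /asboolP gy; apply/asboolP; exact: genD.
apply/asboolP; elim: gx => [|b {}x y Gx _ IH].
  by rewrite scaler0; exact: generated0.
by rewrite scalerDr scalerA; exact: generatedD.
Qed.
HB.instance Definition _ :=
  GRing.isSubmodClosed.Build A M generated_submodule generated_closed.

End GeneratedSubmodule.

Section QuotientModule.
Context {A : nzRingType} {M : lmodType A} (G : set M).

Local Notation S := (generated_submodule G).

(* M / <G>, where <G> is the submodule generated by G. *)
Definition quotient_module : Type := Quotient.quot S.
HB.instance Definition _ := GRing.Zmodule.on quotient_module.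

Definition quot_class (x : M) : quotient_module :=
  (\pi_(Quotient.quot S) x)%qT.

Lemma quot_classP x y : quot_class x = quot_class y <-> x - y \in S.
Proof. by rewrite Quotient.idealrBE; split=> /eqP. Qed.

Lemma quot_class_surj (u : quotient_module) : exists x, u = quot_class x.
Proof. by exists (repr u); rewrite /quot_class reprK. Qed.

Lemma quot_classD : {morph quot_class : x y / x + y}.
Proof. by move=> x y; rewrite /quot_class Quotient.pi_add. Qed.

Definition quot_scale (a : A) (u : quotient_module) : quotient_module :=
  quot_class (a *: repr (u : Quotient.quot S)).

Lemma quot_scaleE a x : quot_scale a (quot_class x) = quot_class (a *: x).
Proof.
apply/quot_classP; rewrite -scalerBr; apply: rpredZ.
by apply/quot_classP; rewrite /quot_class reprK.
Qed.

Fact quot_scaleA a b u : quot_scale a (quot_scale b u) = quot_scale (a * b) u.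
Proof.
by have [x ->] := quot_class_surj u; rewrite !quot_scaleE scalerA.
Qed.
Fact quot_scale1 : left_id 1 quot_scale.
Proof. by move=> u; have [x ->] := quot_class_surj u; rewrite quot_scaleE scale1r. Qed.
Fact quot_scaleDr : right_distributive quot_scale +%R.
Proof.
move=> a u v; have [x ->] := quot_class_surj u; have [y ->] := quot_class_surj v.
by rewrite -quot_classD !quot_scaleE scalerDr quot_classD.
Qed.
Fact quot_scaleDl u : {morph quot_scale^~ u : a b / a + b}.
Proof.
move=> a b; have [x ->] := quot_class_surj u.
by rewrite !quot_scaleE scalerDl quot_classD.
Qed.
HB.instance Definition _ := GRing.Zmodule_isLmodule.Build A quotient_module
  quot_scaleA quot_scale1 quot_scaleDr quot_scaleDl.

End QuotientModule.

Section ExtensionOfScalars.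
Context (A : zmodType) (K : comNzRingType).

(* A \otimes_Z K is the free K-module on the set A modulo the additivity
   relations; a \otimes z is the class of z times the generator a. *)
Definition additivity_relations : set {freeg A / K} :=
  [set z | exists a b : A, z = << a + b >> - << a >> - << b >>].

Definition tensorZ : Type :=
  quotient_module additivity_relations.
HB.instance Definition _ := GRing.Lmodule.on tensorZ.

Definition pure_tensor (a : A) (z : K) : tensorZ :=
  quot_class additivity_relations << z *g a >>.

Lemma tensorZ_ind (P : tensorZ -> Prop) :
  (forall a z, P (pure_tensor a z)) -> (forall u v, P u -> P v -> P (u + v)) ->
  forall u, P u.
Proof.
move=> Ppure PD u; have [D ->] := quot_class_surj u.
rewrite -[D]freeg_sumE; elim: (dom _) => [|a r IH].
  by rewrite big_nil -(freegU0 K (0 : A)); exact: Ppure.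
by rewrite big_cons quot_classD; apply: PD => //; exact: Ppure.
Qed.

Section Map.
Variable f : {additive A -> A}.

Let F (D : {freeg A / K}) : {freeg A / K} :=
  fglift (fun a => << f a >> : {freeg A / K}) D.

Let FB : {morph F : x y / x - y}.
Proof. exact: lift_is_additive. Qed.

Let F0 : F 0 = 0. Proof. by have := FB 0 0; rewrite !subrr. Qed.
Let FN x : F (- x) = - F x. Proof. by rewrite -sub0r FB F0 sub0r. Qed.
Let FD : {morph F : x y / x + y}.
Proof. by move=> x y; rewrite -{1}[y]opprK FB FN opprK. Qed.

Let FU k a : F << k *g a >> = << k *g f a >>.
Proof.
rewrite /F liftU; apply/eqP/freeg_eqP => b.
by rewrite coeffZ !coeffU mul1r.
Qed.

Let FZ k x : F (k *: x) = k *: F x.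
Proof.
have Fsum (I : Type) (r : seq I) (g : I -> {freeg A / K}) :
    F (\sum_(i <- r) g i) = \sum_(i <- r) F (g i).
  by elim: r => [|i r IH]; rewrite ?big_nil ?F0 // !big_cons FD IH.
rewrite -[x]freeg_sumE scaler_sumr !Fsum scaler_sumr; apply: eq_bigr => a _.
have ZU c : k *: << c *g a >> = << k * c *g a >> :> {freeg A / K}.
  by apply/eqP/freeg_eqP => b; rewrite coeffZ !coeffU mulrA.
rewrite ZU !FU; apply/eqP/freeg_eqP => b; rewrite coeffZ !coeffU.
by rewrite mulrA.
Qed.

Let Frel x : x \in generated_submodule additivity_relations ->
  F x \in generated_submodule additivity_relations.
Proof.
move=> /asboolP gx; apply/asboolP; elim: gx => [|k {}x y [a [b ->]] _ IH].
  by rewrite F0; exact: generated0.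
rewrite FD FZ !FB !FU (raddfD f); apply: generatedD => //.
by exists (f a), (f b).
Qed.

Definition tensorZ_map (u : tensorZ) : tensorZ :=
  quot_class _ (F (repr (u : Quotient.quot _))).

Lemma tensorZ_mapE D :
  tensorZ_map (quot_class _ D) =
  quot_class _ (fglift (fun a => << f a >> : {freeg A / K}) D).
Proof.
apply/quot_classP; rewrite -FB; apply: Frel.
by apply/quot_classP; rewrite /quot_class reprK.
Qed.

Lemma tensorZ_map_pure a z : tensorZ_map (pure_tensor a z) = pure_tensor (f a) z.
Proof. by rewrite tensorZ_mapE -/(F _) FU. Qed.

Lemma tensorZ_map_is_linear : linear tensorZ_map.
Proof.
move=> k u v; have [x ->] := quot_class_surj u.
have [y ->] := quot_class_surj v.
have -> : k *: quot_class additivity_relations x + quot_class _ y =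
    quot_class _ (k *: x + y).
  by rewrite quot_classD -quot_scaleE.
rewrite !tensorZ_mapE -!/(F _) FD FZ quot_classD; congr (_ + _).
by rewrite -quot_scaleE.
Qed.
HB.instance Definition _ := GRing.isLinear.Build K tensorZ tensorZ *:%R
  tensorZ_map tensorZ_map_is_linear.

End Map.

Lemma tensorZ_mapK (f g : {additive A -> A}) :
  cancel f g -> cancel (tensorZ_map f) (tensorZ_map g).
Proof.
move=> fK; elim/tensorZ_ind => [a z|u v IHu IHv].
  by rewrite !tensorZ_map_pure fK.
by rewrite !raddfD /= IHu IHv.
Qed.
End ExtensionOfScalars.

Local Notation "p %:F" := (tofrac p) : ring_scope.

Section LaurentRing.
Context (K : fieldType).

(* K[t, t^-1], as the subring of the fractions p / t^n of K(t). *)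
Definition laurent_pred : {pred {fraction {poly K}}} :=
  fun x => `[< exists (p : {poly K}) (n : nat), x = p%:F / ('X^n)%:F >].

Lemma laurent_predP x : reflect
  (exists (p : {poly K}) (n : nat), x = p%:F / ('X^n)%:F) (x \in laurent_pred).
Proof. exact: asboolP. Qed.

Let Xn0 n : ('X^n : {poly K})%:F != 0.
Proof. by rewrite tofrac_eq0 monic_neq0 ?monicXn. Qed.

Fact laurent_closed : subring_closed laurent_pred.
Proof.
split.
- by apply/laurent_predP; exists 1, 0%N; rewrite expr0 tofrac1 divr1.
- move=> _ _ /laurent_predP[p [n ->]] /laurent_predP[q [m ->]].
  apply/laurent_predP; exists (p * 'X^m - q * 'X^n), (n + m)%N.
  rewrite exprD tofracB !tofracM mulrBl -mulf_div divff // mulr1.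
  by rewrite [('X^n)%:F * _]mulrC -mulf_div divff // mulr1.
- move=> _ _ /laurent_predP[p [n ->]] /laurent_predP[q [m ->]].
  apply/laurent_predP; exists (p * q), (n + m)%N.
  by rewrite exprD !tofracM mulf_div.
Qed.
HB.instance Definition _ :=
  GRing.isSubringClosed.Build {fraction {poly K}} laurent_pred laurent_closed.

Record laurent := Laurent {
  laurent_val :> {fraction {poly K}}; _ : laurent_val \in laurent_pred }.
HB.instance Definition _ := [isSub for laurent_val].
HB.instance Definition _ := [Choice of laurent by <:].
HB.instance Definition _ := [SubChoice_isSubComNzRing of laurent by <:].

Lemma laurent_valD : {morph laurent_val : x y / x + y}.
Proof. exact: (raddfD (val : laurent -> {fraction {poly K}})). Qed.
Lemma laurent_valM : {morph laurent_val : x y / x * y}.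
Proof. exact: (rmorphM (val : laurent -> {fraction {poly K}})). Qed.
Lemma laurent_val1 : laurent_val 1 = 1.
Proof. exact: (rmorph1 (val : laurent -> {fraction {poly K}})). Qed.

Fact laurent_poly_subproof (p : {poly K}) : p%:F \in laurent_pred.
Proof. by apply/laurent_predP; exists p, 0%N; rewrite expr0 tofrac1 divr1. Qed.

Definition laurent_poly (p : {poly K}) : laurent :=
  Laurent (laurent_poly_subproof p).

Lemma laurent_frac_exists (x : laurent) :
  exists pn : {poly K} * nat, laurent_val x = pn.1%:F / ('X^(pn.2))%:F.
Proof. by case: x => /= x /laurent_predP[p [n ->]]; exists (p, n). Qed.

Definition laurent_frac (x : laurent) : {poly K} * nat :=
  projT1 (cid (laurent_frac_exists x)).

Lemma laurent_fracE x : laurent_val x =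
  (laurent_frac x).1%:F / ('X^((laurent_frac x).2))%:F.
Proof. by rewrite /laurent_frac; case: cid. Qed.

Lemma laurent_frac_eq (p q : {poly K}) n m :
  p%:F / ('X^n)%:F = q%:F / ('X^m)%:F <-> p * 'X^m = q * 'X^n.
Proof.
split=> [/eqP|e]; first by rewrite eqr_div // -!tofracM tofrac_eq => /eqP.
by apply/eqP; rewrite eqr_div // -!tofracM e.
Qed.

(* For a != 0 the value does not depend on the choice made by laurent_frac,
   see laurent_evalE. *)
Definition laurent_eval (x : laurent) (a : K) : K :=
  (laurent_frac x).1.[a] / a ^+ (laurent_frac x).2.

Lemma laurent_evalE (x : laurent) (p : {poly K}) n a : a != 0 ->
  laurent_val x = p%:F / ('X^n)%:F -> laurent_eval x a = p.[a] / a ^+ n.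
Proof.
move=> a0; rewrite laurent_fracE /laurent_eval; move: (laurent_frac x).
case=> q m /= /laurent_frac_eq/(congr1 (horner^~ a)).
rewrite !hornerM !hornerXn => e; apply/eqP.
by rewrite eqr_div ?expf_neq0 // e.
Qed.

End LaurentRing.

Section LaurentModule.
Context {K : fieldType} {L : lmodType K}.

Record automorphism := Automorphism {
  aut_fun : {linear L -> L};
  aut_inv : {linear L -> L};
  aut_funK : cancel aut_fun aut_inv;
  aut_invK : cancel aut_inv aut_fun }.

(* L with t acting as f: a Laurent polynomial p / t^n acts as p(f) followed by
   the n-th iterate of the inverse of f. *)
Variable f : automorphism.
Local Notation F := (aut_fun f).
Local Notation G := (aut_inv f).

Definition poly_act (p : {poly K}) (v : L) : L :=
  \sum_(i < size p) p`_i *: iter i F v.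

Definition laurent_act (x : laurent K) (v : L) : L :=
  iter (laurent_frac x).2 G (poly_act (laurent_frac x).1 v).

Lemma poly_act_widen n (p : {poly K}) v : (size p <= n)%N ->
  poly_act p v = \sum_(i < n) p`_i *: iter i F v.
Proof.
move=> pn; rewrite /poly_act (big_ord_widen n (fun i => p`_i *: iter i F v)) //.
rewrite [RHS](bigID (fun i : 'I_n => (i < size p)%N)) /= [X in _ + X]big1 ?addr0 //.
by move=> i; rewrite -leqNgt => /(nth_default 0) ->; rewrite scale0r.
Qed.

Lemma poly_actDl p q v : poly_act (p + q) v = poly_act p v + poly_act q v.
Proof.
pose n := maxn (size p) (size q).
rewrite !(@poly_act_widen n) ?leq_maxl ?leq_maxr ?size_polyD //.
by rewrite -big_split; apply: eq_bigr => i _; rewrite coefD scalerDl.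
Qed.

Lemma poly_actZ c p v : poly_act (c *: p) v = c *: poly_act p v.
Proof.
rewrite (@poly_act_widen (size p)) ?size_scale_leq // scaler_sumr.
by apply: eq_bigr => i _; rewrite coefZ scalerA.
Qed.

Lemma poly_actC c v : poly_act c%:P v = c *: v.
Proof.
by rewrite (@poly_act_widen 1) ?size_polyC_leq1 // big_ord1 coefC.
Qed.

Lemma poly_actMX p v : poly_act (p * 'X) v = F (poly_act p v).
Proof.
rewrite (@poly_act_widen (size p).+1); last first.
  by rewrite -['X]scale1r (leq_trans (size_polyMleq _ _)) // scale1r size_polyX addn2.
rewrite big_ord_recl coefMX eqxx scale0r add0r raddf_sum.
by apply: eq_bigr => i _; rewrite coefMX /= linearZ.
Qed.

Lemma poly_act_is_linear p : linear (poly_act p).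
Proof.
move=> k u v; rewrite /poly_act scaler_sumr -big_split; apply: eq_bigr => i _.
have -> : iter i F (k *: u + v) = k *: iter i F u + iter i F v.
  by elim: (i : nat) => //= j ->; rewrite linearP.
by rewrite scalerDr !scalerA [_ * k]mulrC.
Qed.
HB.instance Definition _ p := GRing.isLinear.Build K L L *:%R (poly_act p)
  (poly_act_is_linear p).

Lemma poly_actM p q v : poly_act (p * q) v = poly_act p (poly_act q v).
Proof.
elim/poly_ind: p v => [|p c IH] v.
  by rewrite mul0r -[0]/(0%:P) !poly_actC !scale0r.
rewrite mulrDl mulrAC !poly_actDl !poly_actMX IH; congr (_ + _).
by rewrite mul_polyC poly_actZ poly_actC.
Qed.

Lemma poly_actXn n v : poly_act 'X^n v = iter n F v.
Proof.
elim: n => [|n IH]; first by rewrite expr0 poly_actC scale1r.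
by rewrite exprSr poly_actMX IH.
Qed.

Let FnK n : cancel (iter n F) (iter n G).
Proof. by elim: n => // n IH v; rewrite iterSr iterS aut_funK IH. Qed.
Let GnK n : cancel (iter n G) (iter n F).
Proof. by elim: n => // n IH v; rewrite iterSr iterS aut_invK IH. Qed.

Let iterGD n u v : iter n G (u + v) = iter n G u + iter n G v.
Proof. by elim: n => //= n ->; rewrite raddfD. Qed.

Lemma laurent_actE x p n v : laurent_val x = p%:F / ('X^n)%:F ->
  laurent_act x v = iter n G (poly_act p v).
Proof.
rewrite laurent_fracE /laurent_act; move: (laurent_frac x) => -[q m] /=.
move=> /laurent_frac_eq e; apply: (can_inj (FnK (n + m))).
rewrite iterD GnK addnC iterD GnK -!poly_actXn -!poly_actM.
by rewrite ![_ * p]mulrC ![_ * q]mulrC e.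
Qed.

Definition laurent_module (g : automorphism) : Type := L.
HB.instance Definition _ g := GRing.Zmodule.on (laurent_module g).
Local Notation M := (laurent_module f).

Fact laurent_actA x y (v : M) :
  laurent_act x (laurent_act y v) = laurent_act (x * y) v.
Proof.
have ex := laurent_fracE x; have ey := laurent_fracE y.
move: (laurent_frac x) (laurent_frac y) ex ey => [p n] [q m] /= ex ey.
have exy : laurent_val (x * y) = (p * q)%:F / ('X^(n + m))%:F.
  by rewrite laurent_valM ex ey exprD !tofracM mulf_div.
rewrite (laurent_actE _ ex) (laurent_actE _ ey) (laurent_actE _ exy).
rewrite iterD; congr (iter n G _); apply: (can_inj (FnK m)).
by rewrite GnK -poly_actXn -poly_actM ['X^m * p]mulrC !poly_actM poly_actXn GnK.
Qed.

Fact laurent_act1 : left_id 1 (laurent_act : _ -> M -> _).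
Proof.
move=> v; rewrite (@laurent_actE _ 1 0) ?poly_actC ?scale1r //.
by rewrite laurent_val1 rmorph1 divr1.
Qed.

Fact laurent_actDr :
  right_distributive (laurent_act : _ -> M -> _) +%R.
Proof. by move=> x u v; rewrite /laurent_act raddfD iterGD. Qed.

Fact laurent_actDl (v : M) :
  {morph laurent_act^~ v : x y / x + y}.
Proof.
move=> x y; have ex := laurent_fracE x; have ey := laurent_fracE y.
move: (laurent_frac x) (laurent_frac y) ex ey => [p n] [q m] /= ex ey.
have X0 k : ('X^k : {poly K})%:F != 0 by rewrite tofrac_eq0 monic_neq0 ?monicXn.
have exy : laurent_val (x + y) =
    (p * 'X^m + q * 'X^n)%:F / ('X^(n + m))%:F.
  by rewrite laurent_valD ex ey exprD tofracD !tofracM addf_div.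
rewrite (laurent_actE _ ex) (laurent_actE _ ey) (laurent_actE _ exy).
have FG a b u : iter (a + b) F (iter a G u) = iter b F u.
  by rewrite addnC iterD GnK.
apply: (can_inj (FnK (n + m))); rewrite GnK poly_actDl -[RHS]poly_actXn raddfD /=.
rewrite !poly_actXn (FG n m) [(n + m)%N]addnC (FG m n).
by rewrite ![_ * 'X^_]mulrC !poly_actM !poly_actXn.
Qed.

HB.instance Definition _ := GRing.Zmodule_isLmodule.Build (laurent K)
  M laurent_actA laurent_act1 laurent_actDr laurent_actDl.

Lemma laurent_polyZ (p : {poly K}) (v : M) : laurent_poly p *: v = poly_act p v.
Proof.
have e : laurent_val (laurent_poly p) = p%:F / ('X^0)%:F.
  by rewrite /= rmorph1 divr1.
exact: (laurent_actE _ e).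
Qed.

End LaurentModule.

Section DerivedSubgroup.
Context {G : groupType}.
Local Open Scope group_scope.

Inductive generated_subgroup (S : set G) : G -> Prop :=
| generated_subgroup_in x : S x -> generated_subgroup S x
| generated_subgroup1 : generated_subgroup S 1
| generated_subgroupM x y : generated_subgroup S x -> generated_subgroup S y ->
    generated_subgroup S (x * y)
| generated_subgroupV x : generated_subgroup S x -> generated_subgroup S x^-1.

Definition derived (H : set G) : set G := generated_subgroup
  [set z | exists x y, [/\ H x, H y & z = x * y * x^-1 * y^-1]].

Lemma derived_sub (H : set G) : H 1 -> (forall x y, H x -> H y -> H (x * y)) ->
  (forall x, H x -> H x^-1) -> derived H `<=` H.
Proof.
move=> H1 HM HV x; elim=> {x} [_ [x [y [Hx Hy ->]]]|//|x y _ Hx _ Hy|x _ Hx].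
- by apply: (HM _ _ (HM _ _ (HM _ _ Hx Hy) (HV _ Hx)) (HV _ Hy)).
- exact: HM.
- exact: HV.
Qed.

Lemma derived_conj (H : set G) g : (forall x, H x -> H (g * x * g^-1)) ->
  forall x, derived H x -> derived H (g * x * g^-1).
Proof.
move=> Hg x; elim=> {x} [_ [x [y [Hx Hy ->]]]| |x y _ Hx _ Hy|x _ Hx].
- apply: generated_subgroup_in; exists (g * x * g^-1), (g * y * g^-1).
  split; [exact: Hg|exact: Hg|].
  by rewrite !invgM !invgK !mulgA !mulgVK.
- by rewrite mulg1 mulgV; exact: generated_subgroup1.
- have -> : g * (x * y) * g^-1 = (g * x * g^-1) * (g * y * g^-1).
    by rewrite !mulgA mulgVK.
  exact: generated_subgroupM.
- have -> : g * x^-1 * g^-1 = (g * x * g^-1)^-1.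
    by rewrite !invgM invgK mulgA.
  exact: generated_subgroupV.
Qed.

End DerivedSubgroup.

Section DerivedAbelianization.
Context (G : groupType).
Local Open Scope group_scope.

Local Notation D1 := (derived [set: G]).
Local Notation D2 := (derived D1).

Lemma D1_conj g x : D1 x -> D1 (g * x * g^-1).
Proof. exact: derived_conj. Qed.

Lemma D2_conj g x : D2 x -> D2 (g * x * g^-1).
Proof. by apply: derived_conj => y; exact: D1_conj. Qed.

Definition derived1 : {pred G} := fun x => `[< D1 x >].
Record derived_type := DerivedType {
  derived_val :> G; _ : derived_val \in derived1 }.
HB.instance Definition _ := [isSub for derived_val].
HB.instance Definition _ := [Choice of derived_type by <:].

Lemma derived_valP (x : derived_type) : D1 x.
Proof. by case: x => x /= /asboolP. Qed.

Definition derived_mk x (Dx : D1 x) : derived_type :=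
  @DerivedType x (introT (asboolP _) Dx).

Definition derived_mul (x y : derived_type) : derived_type :=
  derived_mk (generated_subgroupM (derived_valP x) (derived_valP y)).
Definition derived_inv (x : derived_type) : derived_type :=
  derived_mk (generated_subgroupV (derived_valP x)).
Definition derived_one : derived_type := derived_mk (generated_subgroup1 _).
Definition derived_conjg (g : G) (x : derived_type) : derived_type :=
  derived_mk (D1_conj g (derived_valP x)).

(* The quotient of the first by the second derived subgroup. *)
Definition derived_rel (x y : derived_type) : bool :=
  `[< D2 (derived_val x * (derived_val y)^-1) >].

Lemma derived_rel_equiv : equiv_class_of derived_rel.
Proof.
have sym x y : derived_rel x y -> derived_rel y x.
  move=> /asboolP Dxy; apply/asboolP.
  by have := generated_subgroupV Dxy; rewrite invgM invgK.
split=> [x|x y|y x z].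
- by apply/asboolP; rewrite mulgV; exact: generated_subgroup1.
- by apply/idP/idP; exact: sym.
- move=> /asboolP xy /asboolP yz; apply/asboolP.
  by have := generated_subgroupM xy yz; rewrite mulgA mulgVK.
Qed.
Canonical derived_rel_equiv_rel := EquivRelPack derived_rel_equiv.
Canonical derived_rel_encModRel := defaultEncModRel derived_rel.

Definition derived_ab := {eq_quot derived_rel}%qT.
HB.instance Definition _ := EqQuotient.on derived_ab.
HB.instance Definition _ := Choice.on derived_ab.

Definition derived_ab_class (x : derived_type) : derived_ab := (\pi_derived_ab x)%qT.

Lemma derived_ab_classP x y : derived_ab_class x = derived_ab_class y <->
  D2 (derived_val x * (derived_val y)^-1).
Proof.
by split=> [/eqmodP/asboolP|h] //; apply/eqmodP/asboolP.
Qed.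

Lemma derived_ab_class_surj (u : derived_ab) : exists x, u = derived_ab_class x.
Proof. by exists (repr u); rewrite /derived_ab_class reprK. Qed.

Lemma derived_ab_repr x : D2 (derived_val (repr (derived_ab_class x)) * (derived_val x)^-1).
Proof. by apply/derived_ab_classP; rewrite /derived_ab_class reprK. Qed.

Definition derived_ab_add (u v : derived_ab) : derived_ab :=
  derived_ab_class (derived_mul (repr u) (repr v)).
Definition derived_ab_opp (u : derived_ab) : derived_ab := derived_ab_class (derived_inv (repr u)).
Definition derived_ab_zero : derived_ab := derived_ab_class derived_one.

Lemma derived_ab_comm x y : derived_ab_class (derived_mul x y) = derived_ab_class (derived_mul y x).
Proof.
apply/derived_ab_classP => /=; apply: generated_subgroup_in.
exists (derived_val x), (derived_val y); split; try exact: derived_valP.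
by rewrite invgM !mulgA.
Qed.

Lemma derived_ab_addE x y :
  derived_ab_add (derived_ab_class x) (derived_ab_class y) = derived_ab_class (derived_mul x y).
Proof.
apply/derived_ab_classP => /=; move: (derived_ab_repr x) (derived_ab_repr y).
set x' := derived_val (repr _); set y' := derived_val (repr _) => hx hy.
have -> : x' * y' * (derived_val x * derived_val y)^-1 =
  (x' * (y' * (derived_val y)^-1) * x'^-1) * (x' * (derived_val x)^-1).
  by rewrite invgM !mulgA mulgVK.
by apply: generated_subgroupM => //; exact: D2_conj.
Qed.

Lemma derived_ab_oppE x : derived_ab_opp (derived_ab_class x) = derived_ab_class (derived_inv x).
Proof.
apply/derived_ab_classP => /=; move: (derived_ab_repr x).
set x' := derived_val (repr _) => hx.
have := D2_conj x'^-1 (generated_subgroupV hx).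
by rewrite !invgM !invgK !mulgA mulgVK.
Qed.

Fact derived_ab_addA : associative derived_ab_add.
Proof.
move=> u v w; have [x ->] := derived_ab_class_surj u.
have [y ->] := derived_ab_class_surj v; have [z ->] := derived_ab_class_surj w.
by rewrite !derived_ab_addE; congr derived_ab_class; apply: val_inj => /=; rewrite mulgA.
Qed.
Fact derived_ab_addC : commutative derived_ab_add.
Proof.
move=> u v; have [x ->] := derived_ab_class_surj u.
by have [y ->] := derived_ab_class_surj v; rewrite !derived_ab_addE derived_ab_comm.
Qed.
Fact derived_ab_add0 : left_id derived_ab_zero derived_ab_add.
Proof.
move=> u; have [x ->] := derived_ab_class_surj u.
by rewrite derived_ab_addE; congr derived_ab_class; apply: val_inj => /=; rewrite mul1g.
Qed.
Fact derived_ab_addN : left_inverse derived_ab_zero derived_ab_opp derived_ab_add.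
Proof.
move=> u; have [x ->] := derived_ab_class_surj u; rewrite derived_ab_oppE derived_ab_addE.
by congr derived_ab_class; apply: val_inj => /=; rewrite mulVg.
Qed.
HB.instance Definition _ :=
  GRing.isZmodule.Build derived_ab derived_ab_addA derived_ab_addC derived_ab_add0 derived_ab_addN.

Definition derived_ab_conj (g : G) (u : derived_ab) : derived_ab :=
  derived_ab_class (derived_conjg g (repr u)).

Lemma derived_ab_conjE g x :
  derived_ab_conj g (derived_ab_class x) = derived_ab_class (derived_conjg g x).
Proof.
apply/derived_ab_classP => /=; have := D2_conj g (derived_ab_repr x).
by rewrite !invgM invgK !mulgA mulgVK.
Qed.

Fact derived_ab_conj_is_additive g : zmod_morphism (derived_ab_conj g).
Proof.
have D u v : derived_ab_conj g (u + v)%R = (derived_ab_conj g u + derived_ab_conj g v)%R.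
  have [x ->] := derived_ab_class_surj u; have [y ->] := derived_ab_class_surj v.
  rewrite [(_ + _)%R]derived_ab_addE !derived_ab_conjE [RHS]derived_ab_addE.
  by congr derived_ab_class; apply: val_inj => /=; rewrite !mulgA mulgVK.
by move=> u v; have := D (u - v)%R v; rewrite subrK => ->; rewrite addrK.
Qed.
HB.instance Definition _ g := GRing.isZmodMorphism.Build derived_ab derived_ab
  (derived_ab_conj g) (derived_ab_conj_is_additive g).

Lemma derived_ab_conjK g h : (h * g)%g = 1 -> cancel (derived_ab_conj g) (derived_ab_conj h).
Proof.
move=> hg u; have [x ->] := derived_ab_class_surj u; rewrite !derived_ab_conjE.
congr derived_ab_class; apply: val_inj => /=.
by rewrite !mulgA hg mul1g -mulgA -invgM hg invg1 mulg1.
Qed.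

End DerivedAbelianization.

Section AlexanderModule.
Context {G : groupType} (K : fieldType) (mu : G).

Local Notation H := (tensorZ (derived_ab G) K).

(* y \otimes z is mapped to (g * y * g^-1) \otimes z *)
Definition alexander_action (g : G) : {linear H -> H} :=
  tensorZ_map (derived_ab_conj g : {additive derived_ab G -> derived_ab G}).

Fact alexander_actionK g h : (h * g = 1)%g ->
  cancel (alexander_action g) (alexander_action h).
Proof.
by move=> hg; apply: tensorZ_mapK; exact: derived_ab_conjK.
Qed.

Definition alexander_automorphism : automorphism :=
  Automorphism (alexander_actionK (mulVg mu)) (alexander_actionK (mulgV mu)).

Definition alexander_module := laurent_module alexander_automorphism.

Lemma alexander_tE (y : derived_type G) (z : K) :
  laurent_poly 'X *: (pure_tensor (derived_ab_class y) z : alexander_module) =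
  pure_tensor (derived_ab_class (derived_conjg mu y)) z :> alexander_module.
Proof.
rewrite laurent_polyZ -['X]expr1 poly_actXn /=.
apply: etrans (tensorZ_map_pure (derived_ab_conj mu : {additive _ -> _}) _ _) _.
by congr (pure_tensor _ z); exact: derived_ab_conjE.
Qed.

End AlexanderModule.

Section ModuleTheory.
Context {A : comNzRingType}.

(* A / (a) *)
Definition cyclic_module (a : A) : lmodType A :=
  @quotient_module A (A^o : lmodType A) [set a].

(* An isomorphism from M onto the (finite) direct sum of the N i is given by
   its components F i. *)
Definition iso_direct_sum (M : lmodType A) (k : nat) (N : 'I_k -> lmodType A) :
    Prop :=
  exists F : forall i, {linear M -> N i},
    forall y : forall i, N i, exists! x : M, forall i, F i x = y i.

Section PrimaryPart.
Context (M : lmodType A) (a : A).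

Definition primary_pred : {pred M} :=
  fun x => `[< exists N : nat, a ^+ N *: x = 0 >].

Fact primary_closed : subsemimod_closed primary_pred.
Proof.
split=> [|b x /asboolP[N xN]]; last first.
  by apply/asboolP; exists N; rewrite scalerA mulrC -scalerA xN scaler0.
split; first by apply/asboolP; exists 0%N; rewrite scaler0.
move=> x y /asboolP[N xN] /asboolP[N' yN']; apply/asboolP.
exists (N + N')%N; rewrite scalerDr {1}addnC !exprD -!scalerA xN yN'.
by rewrite !scaler0 addr0.
Qed.
HB.instance Definition _ :=
  GRing.isSubmodClosed.Build A M primary_pred primary_closed.

Record primary_part := PrimaryPart {
  primary_val :> M; _ : primary_val \in primary_pred }.
HB.instance Definition _ := [isSub for primary_val].
HB.instance Definition _ := [Choice of primary_part by <:].
HB.instance Definition _ := [SubChoice_isSubLmodule of primary_part by <:].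

End PrimaryPart.

Section OrderIdeal.
Context (M : lmodType A).

(* The rows of P generate the relations between the generators g j of M. *)
Definition is_presentation (r m : nat) (P : 'M[A]_(r, m)) (g : 'I_m -> M) :
    Prop :=
  (forall x : M, exists c : 'rV[A]_m, x = \sum_j c 0 j *: g j) /\
  (forall c : 'rV[A]_m, \sum_j c 0 j *: g j = 0 <->
     exists d : 'rV[A]_r, c = d *m P).

(* The ideal generated by the m x m minors of P.  The choices of rows f which
   are not increasing contribute nothing new: their minors are 0 or, up to
   sign, minors already present. *)
Definition maximal_minors_ideal (r m : nat) (P : 'M[A]_(r, m)) : set A :=
  [set x | exists a : {ffun 'I_m -> 'I_r} -> A,
     x = \sum_f a f * \det (rowsub f P)].

(* The order ideal (zeroth Fitting ideal) does not depend on the chosen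
   presentation of M. *)
Definition generates_order_ideal (d : A) : Prop :=
  exists (r m : nat) (P : 'M[A]_(r, m)) (g : 'I_m -> M),
    is_presentation P g /\
    maximal_minors_ideal P = [set x | exists a : A, x = a * d].

End OrderIdeal.
End ModuleTheory.

Definition has_dimension (K : fieldType) (V : lmodType K) (S : set V)
    (d : nat) : Prop :=
  exists e : 'I_d -> V,
    (forall v, S v <-> exists a : 'I_d -> K, v = \sum_i a i *: e i) /\
    (forall a : 'I_d -> K, \sum_i a i *: e i = 0 -> forall i, a i = 0).

(* deg is the projection G -> G / [G, G], the target being identified with the
   integers in such a way that mu is sent to 1. *)
Definition abelianization_degree (G : groupType) (mu : G) (deg : G -> int) :
    Prop :=
  [/\ forall g h, deg (g * h)%g = deg g + deg h,
      forall g, deg g = 0 <-> derived [set: G] g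
    & deg mu = 1].

Section Representations.
Context {G : groupType} (K : fieldType) (deg : G -> int) (alpha : K).

Definition cochain1 : lmodType K := G -> K^o.

Definition cocycle1 : set cochain1 :=
  [set f | forall g h, f (g * h)%g = f g + alpha ^ deg g * f h].

Definition coboundary1 : set cochain1 :=
  [set f | exists a : K, forall g, f g = (alpha ^ deg g - 1) * a].

Definition mx_zpow (m : nat) (B : 'M[K]_m) (z : int) : 'M[K]_m :=
  match z with
  | Posz k => B ^+ k
  | Negz k => invmx (B ^+ k.+1)
  end.

Definition superdiag (m : nat) : 'M[K]_m :=
  \matrix_(i, j) (j == i.+1 :> nat)%:R.

Definition phi (m : nat) (g : G) : 'M[K]_m :=
  mx_zpow (1%:M + superdiag m) (deg g).

(* For n >= 1 the size 1 + n.-1 is n.  All values are upper triangular with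
   non-zero diagonal entries when alpha != 0, hence invertible. *)
Definition rho (n : nat) (V : 'I_n.-1 -> cochain1) (g : G) :
    'M[K]_(1 + n.-1) :=
  block_mx (alpha ^ deg g)%:M (\row_j V j g) 0 (phi n.-1 g).

Definition is_representation (m : nat) (r : G -> 'M[K]_m) : Prop :=
  forall g h, r (g * h)%g = r g *m r h.

(* The indices start from 0: U is the entry V 0 of V. *)
Definition Cn (n : nat) : set cochain1 :=
  [set U | cocycle1 U /\ exists V : 'I_n.-1 -> cochain1,
     (forall i : 'I_n.-1, i = 0%N :> nat -> V i = U) /\
     is_representation (rho V)].

End Representations.

Section Knots.
Context {R : realType}.
Local Notation I := (`[0%R, 1%R]%classic : set R).

Definition S3 : set 'rV[R]_4 := [set x | \sum_i x 0 i ^+ 2 = 1].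
Definition S1 : set (R * R) := [set z | z.1 ^+ 2 + z.2 ^+ 2 = 1].
Definition disc (r : R) : set (R * R) :=
  [set z | z.1 ^+ 2 + z.2 ^+ 2 <= r ^+ 2].

Definition is_knot (K : set 'rV[R]_4) : Prop :=
  exists g : R * R -> 'rV[R]_4, [/\ {within S1, continuous g},
    forall x y, S1 x -> S1 y -> g x = g y -> x = y,
    forall x, S1 x -> S3 (g x) & K = g @` S1].

(* The tubular neighbourhood is the image of disc 1 x S1.  Requiring tube to be
   an embedding of the larger solid torus disc 2 x S1 makes the boundary of the
   tubular neighbourhood collared, and forces the knot to be tame. *)
Definition is_tubular_embedding (K : set 'rV[R]_4)
    (tube : (R * R) * (R * R) -> 'rV[R]_4) : Prop :=
  [/\ {within disc 2 `*` S1, continuous tube},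
      forall x y, (disc 2 `*` S1) x -> (disc 2 `*` S1) y ->
        tube x = tube y -> x = y,
      forall x, (disc 2 `*` S1) x -> S3 (tube x)
    & K = tube @` ([set (0, 0)] `*` S1)].

Definition tubular_nbhd (tube : (R * R) * (R * R) -> 'rV[R]_4) :
    set 'rV[R]_4 :=
  tube @` (disc 1 `*` S1).

Definition exterior (tube : (R * R) * (R * R) -> 'rV[R]_4) : set 'rV[R]_4 :=
  closure (S3 `\` tubular_nbhd tube).

Definition freely_homotopic (X : set 'rV[R]_4) (p q : R -> 'rV[R]_4) : Prop :=
  exists H : R * R -> 'rV[R]_4, [/\ {within I `*` I, continuous H},
    forall z, (I `*` I) z -> X (H z),
    forall s, I s -> H (0, s) = p s /\ H (1, s) = q s
  & forall u, I u -> H (u, 0) = H (u, 1)].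

(* Both orientations of the meridian circle are obtained by changing tube. *)
Definition is_meridian (tube : (R * R) * (R * R) -> 'rV[R]_4)
    (x0 : exterior tube) (mu : fundamental_group x0) : Prop :=
  exists (p : loop x0) (z : R * R), [/\ mu = loop_class p, S1 z &
    freely_homotopic (exterior tube) p
      (fun s => tube ((cos (2 * pi * s), sin (2 * pi * s)), z))].

End Knots.

(* Main.v *)
Require Import Defs.
From mathcomp Require Import all_boot all_order all_algebra.
From mathcomp Require Import all_classical all_reals all_analysis.
From mathcomp Require Import complex.
From HB Require Import structures.
From mathcomp Require Import perm ring.
From mathcomp.multinomials Require Import freeg.
Set Implicit Arguments.
Unset Strict Implicit.
Unset Printing Implicit Defensive.
Import Order.TTheory GRing.Theory Num.Theory.
Import numFieldNormedType.Exports.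
Local Open Scope classical_set_scope.
Local Open Scope ring_scope.

(** Write [L] for the Laurent polynomial ring, [M] for the Alexander module,
    [s = t - alpha] and [J = 1 + superdiag].

    A family [V] of cochains makes [rho V] a representation exactly when the
    row vector [V g] satisfies [V (g h) = alpha^|g| V h + V g J^|h|]
    ([crossed_homP]), and [Cn] consists of the first coordinates of such [V]
    ([CnP]).  On the derived group this relation says that [V] is additive and
    that conjugation by [mu] multiplies it by [alpha J^-1].  So [V] induces an
    [L]-linear map from [M] to [jordan_module], the space of row vectors on
    which [t] acts by [alpha J^-1], which is a cyclic module [L / (s^(n-1))];
    conversely every such linear map comes from a [V]
    ([linear_of_crossed_hom], [crossed_hom_of_linear]).  Modulo coboundaries,
    [Cn] is therefore the space of those functionals on [M] that are the first
    coordinate of an [L]-linear map to a Jordan block of size [n - 1].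

    Such a map only sees the primary part of [M] at [alpha], a sum of modules
    [L / (s^q_i)].  The generator [b_i] of the i-th summand is killed by
    [s^q_i].  If [q_i < n - 1], every vector of the Jordan block killed by
    [s^q_i] has first coordinate 0, so the functional vanishes at [b_i]; if
    [n - 1 <= q_i], sending [b_i] to a cyclic vector is allowed and the
    functional is free there ([liftable_functionals]).  This gives one
    dimension for each [i] with [n - 1 <= q_i], and the coboundaries give one
    more ([Cn_basis]).

    Two facts about [M] are needed: it is torsion, so that it splits off its
    primary part, and [alpha] is not 1, so that the coboundaries form a line
    that meets the other cocycles only in 0.  Both follow from [M = (t - 1) M],
    which holds for every group whose abelianization is generated by [mu]
    ([alexander_divisible]): Nakayama's determinant trick produces an element
    of the order ideal that annihilates [M] and takes the value 1 at [t = 1]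
    ([divisible_presented_module], [alexander_torsion]). *)

(** * Integer powers of the meridian and the projection to the derived group *)

Section IntegerPowers.
Context {G : groupType}.
Local Open Scope group_scope.

Definition zpow (g : G) (z : int) : G :=
  match z with Posz k => g ^+ k | Negz k => (g ^+ k.+1)^-1 end.

Lemma zpow_succ (g : G) (z : int) : zpow g (z + 1)%R = zpow g z * g.
Proof.
case: z => [k|[|k]] /=.
- by rewrite addn1 expgSr.
- by rewrite expg1 mulVg.
- rewrite subn1 /= [in RHS]expgS invgM mulgVK //.
Qed.

Lemma zpow_pred (g : G) (z : int) : zpow g (z - 1)%R = zpow g z * g^-1.
Proof. by rewrite -{2}[z](subrK 1%R) zpow_succ mulgK. Qed.

Lemma zpowD (g : G) (a b : int) : zpow g (a + b)%R = zpow g a * zpow g b.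
Proof.
elim/int_rect: b => [|b IH|b IH]; first by rewrite addr0 mulg1.
- by rewrite -addn1 PoszD addrA !zpow_succ IH mulgA.
- by rewrite -addn1 PoszD opprD addrA !zpow_pred IH mulgA.
Qed.

Lemma zpowN (g : G) (a : int) : zpow g (- a)%R = (zpow g a)^-1.
Proof. by apply: (mulgI (zpow g a)); rewrite -zpowD subrr mulgV. Qed.

End IntegerPowers.

Section DerivedPart.
Context {G : groupType} (mu : G) (deg : G -> int).
Hypothesis degP : abelianization_degree mu deg.
Local Open Scope group_scope.

Let degM g h : deg (g * h) = (deg g + deg h)%R. Proof. by case: degP. Qed.
Let deg_mu : deg mu = 1%R. Proof. by case: degP. Qed.
Lemma deg_eq0P g : deg g = 0%R <-> derived [set: G] g.
Proof. by case: degP. Qed.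

Lemma deg1 : deg 1 = 0%R.
Proof. by apply/deg_eq0P; exact: generated_subgroup1. Qed.

Lemma degV g : deg g^-1 = (- deg g)%R.
Proof. by apply/eqP; rewrite -addr_eq0 -degM mulVg deg1. Qed.

Lemma deg_zpow z : deg (zpow mu z) = z.
Proof.
elim/int_rect: z => [|b IH|b IH]; first exact: deg1.
- by rewrite -addn1 PoszD zpow_succ degM IH deg_mu.
- by rewrite -addn1 PoszD opprD zpow_pred degM IH degV deg_mu.
Qed.

Lemma derived_part_subproof g : derived [set: G] (g * zpow mu (- deg g)%R).
Proof. by apply/deg_eq0P; rewrite degM deg_zpow subrr. Qed.

(** The product decomposition [g = (g mu^-|g|) mu^|g|] splits [G] as a
    semidirect product; this is the class of the first factor. *)
Definition derived_part g : derived_ab G :=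
  derived_ab_class (derived_mk (derived_part_subproof g)).

(** Moving [mu^|g|] past the derived factor of [h] conjugates that factor. *)
Lemma derived_partM g h : derived_part (g * h) =
  (derived_part g + derived_ab_conj (zpow mu (deg g)) (derived_part h))%R.
Proof.
rewrite /derived_part derived_ab_conjE; apply: etrans (esym (derived_ab_addE _ _)).
congr derived_ab_class; apply: val_inj => /=.
by rewrite degM opprD [(- _ - _)%R]addrC zpowD !zpowN !mulgA mulgVK.
Qed.

Lemma derived_part_derived (x : derived_type G) :
  derived_part (derived_val x) = derived_ab_class x.
Proof.
congr derived_ab_class; apply: val_inj => /=.
by rewrite (iffRL (deg_eq0P _) (derived_valP x)) oppr0 mulg1.
Qed.

Lemma derived_part_mu : derived_part mu = 0%R.
Proof.
congr derived_ab_class; apply: val_inj => /=.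
by rewrite deg_mu zpowN mulgV.
Qed.

Lemma derived_ab_conj1 u : derived_ab_conj (1 : G) u = u.
Proof.
have [x ->] := derived_ab_class_surj u; rewrite derived_ab_conjE.
by congr derived_ab_class; apply: val_inj; rewrite /= invg1 mul1g mulg1.
Qed.

Lemma derived_ab_conjM (g h : G) u :
  derived_ab_conj (g * h) u = derived_ab_conj g (derived_ab_conj h u).
Proof.
have [x ->] := derived_ab_class_surj u; rewrite !derived_ab_conjE.
by congr derived_ab_class; apply: val_inj; rewrite /= invgM !mulgA.
Qed.

(** The subgroup [(t - 1) A] of [A = derived_ab G]. *)
Definition conj_diff : set (derived_ab G) :=
  [set u | exists v, u = (derived_ab_conj mu v - v)%R].

Lemma conj_diffD u v : conj_diff u -> conj_diff v -> conj_diff (u + v)%R.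
Proof. by move=> [a ->] [b ->]; exists (a + b)%R; rewrite raddfD opprD addrACA. Qed.

Lemma conj_diffN u : conj_diff u -> conj_diff (- u)%R.
Proof. by move=> [a ->]; exists (- a)%R; rewrite raddfN opprD. Qed.

Lemma conj_diff_zpow z u : conj_diff (derived_ab_conj (zpow mu z) u - u)%R.
Proof.
elim/int_rect: z u => [u|b IH u|b IH u].
- by exists 0%R; rewrite /= derived_ab_conj1 raddf0 !subrr.
- rewrite -addn1 PoszD zpow_succ derived_ab_conjM.
  set v := derived_ab_conj mu u.
  rewrite -(subrK v (derived_ab_conj _ v)) -addrA.
  by apply: conj_diffD; [exact: IH|exists u].
- rewrite -addn1 PoszD opprD zpow_pred derived_ab_conjM.
  set v := derived_ab_conj mu^-1 u.
  rewrite -(subrK v (derived_ab_conj _ v)) -addrA.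
  apply: conj_diffD; first exact: IH.
  have -> : u = derived_ab_conj mu v by rewrite -derived_ab_conjM mulgV derived_ab_conj1.
  by rewrite -opprB; apply: conj_diffN; exists v.
Qed.

Lemma derived_part_crossed g h : exists2 d, conj_diff d &
  derived_part (g * h) = (derived_part g + derived_part h + d)%R.
Proof.
exists (derived_ab_conj (zpow mu (deg g)) (derived_part h) - derived_part h)%R.
  exact: conj_diff_zpow.
by rewrite derived_partM -addrA; congr (_ + _)%R; rewrite addrC subrK.
Qed.

(** Modulo [(t - 1) A] the conjugations act trivially, so the derived part
    becomes a homomorphism to an abelian group.  It kills all commutators and
    it restricts to the canonical projection of the derived group, hence
    [A = (t - 1) A]. *)
Lemma conj_diff_surj u : conj_diff u.
Proof.
have part1 : derived_part 1 = 0%R.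
  congr derived_ab_class; apply: val_inj => /=.
  by rewrite deg1 oppr0 mulg1.
have conjD0 : conj_diff 0%R by exists 0%R; rewrite raddf0 subrr.
have partV g : exists2 d, conj_diff d & derived_part g^-1 = (- derived_part g + d)%R.
  have [d Dd] := derived_part_crossed g g^-1; rewrite mulgV part1 => e.
  exists (- d)%R; first exact: conj_diffN.
  by apply/eqP; rewrite -opprD -addr_eq0 addrCA addrA -e.
have [x ->] := derived_ab_class_surj u; rewrite -derived_part_derived.
have := derived_valP x; move: (derived_val x) => {}x.
elim=> {x} [_ [g [h [_ _ ->]]]||g h _ Dg _ Dh|g _ Dg].
- have [a Da ->] := derived_part_crossed (g * h * g^-1) h^-1.
  have [b Db ->] := derived_part_crossed (g * h) g^-1.
  have [c Dc ->] := derived_part_crossed g h.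
  have [d Dd ->] := partV g; have [f Df ->] := partV h.
  have -> : (derived_part g + derived_part h + c + (- derived_part g + d) + b +
    (- derived_part h + f) + a = c + d + b + f + a)%R.
    set X := derived_part g; set Y := derived_part h.
    by rewrite [LHS](AC (2*1*2*1*2*1) ((1*4)*(2*7)*(3*5*6*8*9))) /= !subrr !add0r.
  by do !apply: conj_diffD.
- by rewrite part1.
- have [d Dd ->] := derived_part_crossed g h.
  by do !apply: conj_diffD.
- by have [d Dd ->] := partV g; apply: conj_diffD => //; exact: conj_diffN.
Qed.
End DerivedPart.

(** * The Alexander module: maps out of a tensor product, Laurent polynomials *)

Section TensorLift.
Context (A : zmodType) (K : comNzRingType) (L : lmodType K).

Lemma freegUZ (c k : K) (a : A) : c *: << k *g a >> = << c * k *g a >> :> {freeg A / K}.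
Proof. by apply/eqP/freeg_eqP => b; rewrite coeffZ !coeffU mulrA. Qed.

Lemma pure_tensorZ (c z : K) (a : A) : pure_tensor a (c * z) = c *: pure_tensor a z.
Proof. by rewrite /pure_tensor -freegUZ -quot_scaleE. Qed.

Lemma pure_tensorDl (a b : A) (z : K) :
  pure_tensor (a + b) z = pure_tensor a z + pure_tensor b z.
Proof.
rewrite -[z]mulr1 !pure_tensorZ -scalerDr; congr (_ *: _).
rewrite /pure_tensor -quot_classD; apply/quot_classP/asboolP.
rewrite -[X in generated _ X]addr0 -[X in X + 0]scale1r.
apply: generatedD; last exact: generated0.
by exists a, b; rewrite opprD addrA.
Qed.

Lemma pure_tensorBl (a b : A) (z : K) :
  pure_tensor (a - b) z = pure_tensor a z - pure_tensor b z.
Proof. by apply/eqP; rewrite eq_sym subr_eq -pure_tensorDl subrK. Qed.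

Lemma pure_tensor0l (z : K) : pure_tensor (0 : A) z = 0.
Proof. by rewrite -[X in pure_tensor X]subr0 pure_tensorBl subrr. Qed.

Variable f : {additive A -> L}.

Let FB : {morph (fglift f : {freeg A / K} -> L) : x y / x - y}.
Proof. exact: lift_is_additive. Qed.
Let F0 : fglift f 0 = 0. Proof. by have := FB 0 0; rewrite !subrr. Qed.
Let FN x : fglift f (- x) = - fglift f x. Proof. by rewrite -sub0r FB F0 sub0r. Qed.
Let FD : {morph (fglift f : {freeg A / K} -> L) : x y / x + y}.
Proof. by move=> x y; rewrite -{1}[y]opprK FB FN opprK. Qed.
Let FZ k x : fglift f (k *: x) = k *: fglift f x.
Proof.
rewrite -[x]freeg_sumE scaler_sumr; elim: (dom x) => [|a r IH].
  by rewrite !big_nil F0 scaler0.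
by rewrite !big_cons !FD scalerDr IH freegUZ !liftU scalerA.
Qed.
Let Frel x : x \in generated_submodule (@additivity_relations A K) -> fglift f x = 0.
Proof.
move=> /asboolP; elim=> // k {}x y [a [b ->]] _ IH.
by rewrite FD FZ !FB !liftU IH !scale1r (raddfD f) addrAC addrK subrr scaler0 addr0.
Qed.

(** The universal property of extension of scalars. *)
Lemma tensorZ_lift_exists : exists h : {linear tensorZ A K -> L},
  forall a z, h (pure_tensor a z) = z *: f a.
Proof.
pose h (u : tensorZ A K) : L := fglift f (repr (u : Quotient.quot _)).
have hE D : h (quot_class _ D) = fglift f D.
  apply/eqP; rewrite -subr_eq0 -FB; apply/eqP/Frel.
  by apply/quot_classP; rewrite /quot_class reprK.
have h_linear : linear h.
  move=> k u v; have [x ->] := quot_class_surj u; have [y ->] := quot_class_surj v.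
  have -> : k *: quot_class (@additivity_relations A K) x + quot_class _ y =
      quot_class _ (k *: x + y) by rewrite quot_classD -quot_scaleE.
  by rewrite !hE FD FZ.
pose hM := GRing.isLinear.Build K (tensorZ A K) L *:%R h h_linear.
pose hl : {linear tensorZ A K -> L} := HB.pack h hM.
by exists hl => a z; rewrite -[LHS]/(h _) hE liftU.
Qed.

End TensorLift.

Section LaurentEval.
Context (K : fieldType).

Lemma laurent_poly_is_zmod : zmod_morphism (@laurent_poly K).
Proof. by move=> p q; apply: val_inj; rewrite /= rmorphB. Qed.
Lemma laurent_poly_is_monoid : monoid_morphism (@laurent_poly K).
Proof. by split=> [|p q]; apply: val_inj; rewrite /= ?rmorph1 ?rmorphM. Qed.
HB.instance Definition _ := GRing.isZmodMorphism.Build {poly K} (laurent K)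
  (@laurent_poly K) laurent_poly_is_zmod.
HB.instance Definition _ := GRing.isMonoidMorphism.Build {poly K} (laurent K)
  (@laurent_poly K) laurent_poly_is_monoid.

Lemma laurent_clear_denominator (x : laurent K) :
  exists p n, x * laurent_poly 'X^n = laurent_poly p.
Proof.
exists (laurent_frac x).1, (laurent_frac x).2; apply: val_inj => /=.
by rewrite laurent_fracE divfK // tofrac_eq0 monic_neq0 ?monicXn.
Qed.

Variables (a : K) (a_neq0 : a != 0).

Lemma laurent_eval_poly p : laurent_eval (laurent_poly p) a = p.[a].
Proof.
by rewrite (@laurent_evalE _ _ p 0) ?expr0 ?divr1 //= rmorph1 divr1.
Qed.

(** Multiplicativity in this special case suffices: after multiplication by a
    power of [t], which evaluates to a nonzero scalar, every identity between
    evaluations reduces to one between polynomials. *)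
Lemma laurent_evalMpoly (x : laurent K) p :
  laurent_eval (x * laurent_poly p) a = laurent_eval x a * p.[a].
Proof.
rewrite (@laurent_evalE _ _ ((laurent_frac x).1 * p) (laurent_frac x).2) //.
  by rewrite hornerM mulrAC.
by rewrite /= laurent_fracE rmorphM mulrAC.
Qed.

Lemma laurent_eval_is_zmod : zmod_morphism (fun x : laurent K => laurent_eval x a).
Proof.
move=> x y.
have [p [n xE]] := laurent_clear_denominator x.
have [q [m yE]] := laurent_clear_denominator y.
have anz : ('X^n * 'X^m).[a] != 0 by rewrite hornerM !hornerXn mulf_neq0 ?expf_neq0.
apply: (mulIf anz); rewrite mulrBl -!laurent_evalMpoly rmorphM /= mulrBl.
rewrite mulrA xE [laurent_poly 'X^n * _]mulrC mulrA yE -!rmorphM -rmorphB /=.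
by rewrite !laurent_eval_poly hornerD hornerN.
Qed.

Lemma laurent_eval_is_monoid : monoid_morphism (fun x : laurent K => laurent_eval x a).
Proof.
split=> [|x y]; first by rewrite -(rmorph1 (@laurent_poly K)) laurent_eval_poly hornerC.
have [p [n xE]] := laurent_clear_denominator x.
have [q [m yE]] := laurent_clear_denominator y.
have anz : ('X^n * 'X^m).[a] != 0 by rewrite hornerM !hornerXn mulf_neq0 ?expf_neq0.
apply: (mulIf anz); rewrite -laurent_evalMpoly hornerM mulrACA.
by rewrite -!laurent_evalMpoly rmorphM /= mulrACA xE yE -rmorphM !laurent_eval_poly hornerM.
Qed.

Lemma laurent_eval_exists :
  exists ev : {rmorphism laurent K -> K}, forall x, ev x = laurent_eval x a.
Proof.
pose f (x : laurent K) := laurent_eval x a.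
pose fA := GRing.isZmodMorphism.Build (laurent K) K f laurent_eval_is_zmod.
pose fM := GRing.isMonoidMorphism.Build (laurent K) K f laurent_eval_is_monoid.
pose ev : {rmorphism laurent K -> K} := HB.pack f fA fM.
by exists ev.
Qed.

End LaurentEval.

Section LaurentModuleMorphism.
Context {K : fieldType} {L L' : lmodType K}.
Variables (f : @automorphism K L) (g : @automorphism K L') (h : {linear L -> L'}).
Hypothesis hfg : forall v, h (aut_fun f v) = aut_fun g (h v).

(** A linear map that commutes with the action of [t] commutes with the action
    of [t^-1], hence with all Laurent polynomials. *)
Lemma laurent_linear_exists :
  exists h' : {linear laurent_module f -> laurent_module g}, forall v, h' v = h v.
Proof.
have hV v : h (aut_inv f v) = aut_inv g (h v).
  by apply: (can_inj (aut_funK g)); rewrite -hfg !aut_invK.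
have hZ (x : laurent K) v : h (laurent_act f x v) = laurent_act g x (h v).
  rewrite /laurent_act /poly_act; move: (laurent_frac x) => [p n] /=.
  elim: n => [|n IH]; last by rewrite !iterS hV IH.
  rewrite /= linear_sum; apply: eq_bigr => i _; rewrite linearZ /=; congr (_ *: _).
  by elim: (nat_of_ord i) => //= j <-; rewrite hfg.
have h_linear : linear (h : laurent_module f -> laurent_module g).
  by move=> x u v; rewrite [LHS]raddfD; congr (_ + _); exact: hZ.
pose h' : laurent_module f -> laurent_module g := h.
pose hM := GRing.isLinear.Build (laurent K) (laurent_module f) (laurent_module g)
  *:%R h' h_linear.
pose hl : {linear laurent_module f -> laurent_module g} := HB.pack h' hM.
by exists hl.
Qed.

End LaurentModuleMorphism.

(** * Torsion of presented modules *)

Section Determinants.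
Context {A : comNzRingType}.

(** The Cauchy-Binet expansion before grouping the row selections by their
    image.  It shows that the determinant of a combination of relations lies in
    the ideal of maximal minors. *)
Lemma det_mulmx_rowsub (m r : nat) (D : 'M[A]_(m, r)) (P : 'M[A]_(r, m)) :
  \det (D *m P) = \sum_(f : {ffun 'I_m -> 'I_r}) (\prod_i D i (f i)) * \det (rowsub f P).
Proof.
transitivity (\sum_(s : {perm 'I_m}) \sum_(f : {ffun 'I_m -> 'I_r})
    (-1) ^+ s * \prod_i (D i (f i) * P (f i) (s i))).
  apply: eq_bigr => s _; rewrite -big_distrr /=; congr (_ * _).
  rewrite -(bigA_distr_bigA (fun i j => D i j * P j (s i))).
  by apply: eq_bigr => i _; rewrite mxE.
rewrite exchange_big; apply: eq_bigr => f _; rewrite big_distrr /=.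
apply: eq_bigr => s _; rewrite big_split /= mulrCA; congr (_ * (_ * _)).
by apply: eq_bigr => i _; rewrite mxE.
Qed.

(** The determinant trick: if [g = a C g] for the column [g] of generators,
    then [1 - a C] is a matrix of relations, so its determinant lies in the
    ideal of maximal minors and, by Cramer's rule, annihilates the generators.
    Modulo [a] this determinant is that of the identity. *)
Lemma divisible_presented_module (M : lmodType A) (r m : nat) (P : 'M[A]_(r, m))
    (g : 'I_m -> M) (a : A) :
  is_presentation P g -> (forall x : M, exists z, x = a *: z) ->
  exists d, [/\ maximal_minors_ideal P d, forall x : M, d *: x = 0 &
    forall (B : comNzRingType) (ev : {rmorphism A -> B}), ev a = 0 -> ev d = 1].
Proof.
move=> [gen rel] adiv.
have /fin_all_exists[c cE] (j : 'I_m) : exists c : 'rV[A]_m, g j = a *: \sum_k c 0 k *: g k.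
  by have [z ->] := adiv (g j); have [c ->] := gen z; exists c.
pose B := 1%:M - a *: \matrix_j c j.
have BE j : \sum_k B j k *: g k = 0.
  apply/eqP; under eq_bigr => k _ do rewrite !mxE scalerBl -scalerA.
  rewrite sumrB -scaler_sumr -cE subr_eq0 (bigD1 j) //= eqxx scale1r big1 ?addr0 //.
  by move=> i /negbTE; rewrite eq_sym => ->; rewrite scale0r.
have /fin_all_exists[D DE] (j : 'I_m) : exists d : 'rV[A]_r, row j B = d *m P.
  by apply/rel; under eq_bigr => k _ do rewrite mxE; exact: BE.
exists (\det B); split.
- have -> : B = (\matrix_j D j) *m P by apply/row_matrixP => j; rewrite row_mul rowK.
  by rewrite det_mulmx_rowsub; eexists.
- move=> x; have [y ->] := gen x; rewrite scaler_sumr big1 // => i _.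
  have -> : \det B *: (y 0 i *: g i) = y 0 i *: (\det B *: g i).
    by rewrite !scalerA mulrC.
  have -> : \det B *: g i = \sum_k (\adj B *m B) i k *: g k.
    rewrite mul_adj_mx (bigD1 i) //= mxE eqxx mulr1n big1 ?addr0 // => k.
    by move/negbTE; rewrite mxE eq_sym => ->; rewrite mulr0n scale0r.
  under eq_bigr => k _ do rewrite mxE scaler_suml.
  rewrite exchange_big big1 ?scaler0 // => j _.
  by under eq_bigr => k _ do rewrite -scalerA; rewrite -scaler_sumr BE scaler0.
- move=> R ev ev0; rewrite -det_map_mx -[RHS](det1 R m); congr (\det _).
  by apply/matrixP => i j; rewrite !mxE rmorphB rmorphM ev0 mul0r subr0 rmorph_nat.
Qed.

End Determinants.

Section PrimaryProjection.
Context {K : fieldType} (M : lmodType (laurent K)) (alpha : K).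
Local Notation s := (laurent_poly ('X - alpha%:P)).

(** Write [p = p' (t - alpha)^N] with [p'] prime to [t - alpha].  A Bezout
    relation [u p' + v s^m = 1] makes [u p' = 1 - v s^m] an element which maps
    [M] into its primary part and acts as the identity on every module killed
    by [s^m]. *)
Lemma primary_projection (p : {poly K}) (m : nat) : p != 0 ->
  (forall x : M, laurent_poly p *: x = 0) ->
  exists a : laurent K, forall x : M, exists N, s ^+ N *: ((1 - a * s ^+ m) *: x) = 0.
Proof.
move=> p0 pM; have [N [p' + pE]] := multiplicity_XsubC p alpha.
rewrite p0 /= => p'0.
have : coprimep p' (('X - alpha%:P) ^+ m).
  by rewrite coprimep_expr // coprimep_XsubC.
move/Bezout_eq1_coprimepP => [[u v] /= uv].
exists (laurent_poly v) => x; exists N; rewrite scalerA.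
have -> : 1 - laurent_poly v * s ^+ m = laurent_poly (u * p').
  by rewrite -(rmorphXn (@laurent_poly K)) -(rmorphM (@laurent_poly K)) -(rmorph1 (@laurent_poly K))
    -rmorphB /= -uv addrK.
by rewrite -(rmorphXn (@laurent_poly K)) -(rmorphM (@laurent_poly K)) mulrCA
  [_ * p']mulrC -pE rmorphM -scalerA pM scaler0.
Qed.

End PrimaryProjection.

(** * Functionals that lift to a Jordan block *)

Section CyclicModules.
Context {A : comNzRingType}.

Definition cyclic_class (c a : A) : cyclic_module c := @quot_class A A^o [set c] a.

Lemma cyclic_class_surj c (u : cyclic_module c) : exists a, u = cyclic_class c a.
Proof. exact: (@quot_class_surj A A^o). Qed.

(** The submodule generated by [c] is the principal ideal [(c)]. *)
Lemma cyclic_class_eq (c a b : A) :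
  cyclic_class c a = cyclic_class c b <-> exists d, a - b = d * c.
Proof.
split=> [/quot_classP/asboolP|[d dE]]; last first.
  apply/quot_classP/asboolP; rewrite -[X in generated _ X]addr0 dE.
  by apply: (@generatedD A A^o) => //; exact: generated0.
elim=> [|e x y -> _ [d dE]]; first by exists 0; rewrite mul0r.
by exists (e + d); rewrite mulrDl -dE.
Qed.

Lemma cyclic_class_is_linear c : linear (cyclic_class c : A^o -> _).
Proof.
move=> k x y; rewrite /cyclic_class quot_classD; congr (_ + _).
exact/esym/(@quot_scaleE A A^o).
Qed.
HB.instance Definition _ c := GRing.isLinear.Build A A^o (cyclic_module c) *:%R
  (cyclic_class c : A^o -> _) (cyclic_class_is_linear c).

Lemma cyclic_classZ c a b : a *: cyclic_class c b = cyclic_class c (a * b).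
Proof. exact: (@quot_scaleE A A^o). Qed.

Lemma cyclic_module_lift (c : A) (T : lmodType A) (v : T) : c *: v = 0 ->
  exists h : {linear cyclic_module c -> T},
    forall a : A, h (cyclic_class (c) (a)) = a *: v.
Proof.
move=> cv0; pose h (u : cyclic_module c) : T := (repr (u : Quotient.quot _) : A) *: v.
have hE (a : A) : h (cyclic_class (c) (a)) = a *: v.
  apply/eqP; rewrite -subr_eq0 -scalerBl; apply/eqP.
  set r := repr _; have : cyclic_class (c) (r) = cyclic_class (c) (a).
    exact: reprK.
  by move/cyclic_class_eq => [d ->]; rewrite -scalerA cv0 scaler0.
have h_linear : linear h.
  move=> k u w; have [x ->] := cyclic_class_surj u; have [y ->] := cyclic_class_surj w.
  by rewrite -linearP !hE scalerDl scalerA.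
pose hM := GRing.isLinear.Build A (cyclic_module c) T *:%R h h_linear.
pose hl : {linear cyclic_module c -> T} := HB.pack h hM.
by exists hl.
Qed.

End CyclicModules.

Section LiftableFunctionals.
Context {A : comNzRingType} {K : fieldType} (ev : {rmorphism A -> K}) (s : A).
Hypothesis ev_s : ev s = 0.
Context {T : lmodType A} (eps : T -> K) (v0 : T) (m : nat).
Hypothesis epsD : {morph eps : u v / u + v}.
Hypothesis epsZ : forall a v, eps (a *: v) = ev a * eps v.
Hypothesis eps_v0 : eps v0 = 1.
Hypothesis sm_T : forall v : T, s ^+ m *: v = 0.
Hypothesis sq_T : forall (v : T) q, s ^+ q *: v = 0 -> (q < m)%N -> eps v = 0.
Hypothesis m_gt0 : (0 < m)%N.
Context {M : lmodType A} (a : A) (k : nat) (q : 'I_k -> nat).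
Hypothesis q_gt0 : forall i, (0 < q i)%N.
Hypothesis iso : iso_direct_sum (primary_part M s) (fun i => cyclic_module (s ^+ q i)).
Hypothesis e_primary : forall x : M, exists N, s ^+ N *: ((1 - a * s ^+ m) *: x) = 0.

(** Here [T] stands for a Jordan block of size [m] with first coordinate [eps]
    and cyclic vector [v0].  The vector [b i] generates the i-th summand of the
    primary part, and [f i] is the i-th coordinate, reduced modulo [s], of the
    projection [e x] of [x] to the primary part.  Since [e] acts as the
    identity on [T], a linear map [W] is determined by its values at the [b i],
    and [eps] only depends on the coordinates of [e x] modulo [s]. *)
Lemma liftable_functionals : exists (b : 'I_k -> M) (f : 'I_k -> M -> K),
  [/\ forall i j, f i (b j) = (i == j)%:R,
      forall i, (m <= q i)%N -> exists W : {linear M -> T}, forall x, f i x = eps (W x),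
      forall (W : {linear M -> T}) x, eps (W x) = \sum_i f i x * eps (W (b i))
    & forall (W : {linear M -> T}) i, (q i < m)%N -> eps (W (b i)) = 0].
Proof.
have [F Fiso] := iso.
have Finj (x y : primary_part M s) : (forall i, F i x = F i y) -> x = y.
  by move=> xy; have [z [_ uz]] := Fiso (fun i => F i y); rewrite -(uz x xy) -(uz y).
have eps0 : eps 0 = 0 by rewrite -(scale0r v0) epsZ rmorph0 mul0r.
pose e := 1 - a * s ^+ m.
have ev_e : ev e = 1.
  by rewrite rmorphB rmorphM rmorphXn ev_s expr0n gtn_eqF // mulr0 subr0 rmorph1.
pose p (x : M) : primary_part M s := PrimaryPart
  (introT (asboolP _) (e_primary x : exists N, s ^+ N *: (e *: x) = 0)).
have p_linear : linear p.
  by move=> c x y; apply: val_inj; rewrite /= scalerDr !scalerA [e * c]mulrC.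
have /fin_all_exists[b bE] (i : 'I_k) : exists b : primary_part M s,
    forall j, F j b = cyclic_class (s ^+ q j) ((i == j)%:R).
  by have [x [xE _]] := Fiso (fun j => cyclic_class (s ^+ q j) ((i == j)%:R)); exists x.
have FE (i : 'I_k) (c : A) j :
    F j (c *: b i) = cyclic_class (s ^+ q j) (c * (i == j)%:R).
  by rewrite linearZ /= bE cyclic_classZ.
have decomp (x : primary_part M s) (c : 'I_k -> A) :
    (forall i, F i x = cyclic_class (s ^+ q i) (c i)) -> x = \sum_i c i *: b i.
  move=> xE; apply: Finj => j; rewrite raddf_sum (bigD1 j) //= FE eqxx mulr1 xE.
  by rewrite big1 ?addr0 // => i /negbTE ij; rewrite FE ij mulr0 linear0.
have sb i : s ^+ q i *: b i = 0.
  apply: Finj => j; rewrite FE raddf0 -(linear0 (cyclic_class (s ^+ q j))).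
  apply/cyclic_class_eq; rewrite subr0; case: eqVneq => [->|_].
    by exists 1; rewrite mulr1 mul1r.
  by exists 0; rewrite mulr0 mul0r.
(* c i x is a representative of the i-th coordinate of e x *)
pose c i x : A := repr (F i (p x) : Quotient.quot _).
have cE i x : F i (p x) = cyclic_class (s ^+ q i) (c i x).
  exact/esym/reprK.
have ev_class i (x y : A) :
    cyclic_class (s ^+ q i) x = cyclic_class (s ^+ q i) y -> ev x = ev y.
  move/cyclic_class_eq => [d dE]; apply/eqP; rewrite -subr_eq0 -rmorphB dE.
  by rewrite rmorphM rmorphXn ev_s expr0n gtn_eqF ?mulr0.
exists (fun i => val (b i)), (fun i x => ev (c i x)); split.
- move=> i j; have -> : (i == j)%:R = ev (e * (j == i)%:R).
    by rewrite rmorphM ev_e mul1r rmorph_nat eq_sym.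
  apply: (ev_class i) => /=; rewrite -cE -FE; congr (F i _); exact: val_inj.
- move=> i mq; have [|h hE] := @cyclic_module_lift _ (s ^+ q i) T v0.
    by rewrite -(subnK mq) exprD -scalerA sm_T scaler0.
  have W_linear : linear (fun x => h (F i (p x))).
    by move=> d x y; rewrite p_linear !linearP.
  pose WM := GRing.isLinear.Build A M T *:%R _ W_linear.
  pose W : {linear M -> T} := HB.pack (fun x => h (F i (p x))) WM.
  by exists W => x; rewrite -[W x]/(h (F i (p x))) cE hE epsZ eps_v0 mulr1.
- move=> W x; have -> : W x = W (val (p x)).
    (* e acts on T as the identity since s ^+ m kills T *)
    by rewrite [RHS]linearZ /= scalerBl scale1r -scalerA sm_T scaler0 subr0.
  rewrite (decomp (p x) (c^~ x) (fun i => cE i x)) (raddf_sum val).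
  rewrite linear_sum (big_morph eps epsD eps0).
  by apply: eq_bigr => i _; rewrite -epsZ -linearZ.
- move=> W i; apply: sq_T; rewrite -linearZ /=.
  have -> : s ^+ q i *: val (b i) = val (s ^+ q i *: b i) by [].
  by rewrite sb linear0.
Qed.

End LiftableFunctionals.

(** * A single Jordan block as a Laurent module *)

Section JordanModule.
Context {K : fieldType} (m : nat).
Local Notation N := (superdiag K m.+1).
Local Notation J := (1%:M + N : 'M[K]_m.+1).

Lemma mulmx_superdiag (v : 'rV[K]_m.+1) (j : 'I_m.+1) :
  (v *m N) 0 j = if (0 < j)%N then v 0 (inord j.-1) else 0.
Proof.
rewrite mxE; case: ifP => [j0|/negbT]; last first.
  rewrite -eqn0Ngt => /eqP j0; rewrite big1 // => i _.
  by rewrite mxE j0 mulr0.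
have jm : (j.-1 < m.+1)%N by rewrite (leq_ltn_trans (leq_pred _)).
rewrite (bigD1 (inord j.-1)) //= mxE inordK // prednK // eqxx mulr1.
rewrite big1 ?addr0 // => i ij; rewrite mxE; case: eqP => [ji|_]; last by rewrite mulr0.
by case/eqP: ij; apply: val_inj; rewrite /= inordK // ji.
Qed.

Lemma mulmx_superdiagX (v : 'rV[K]_m.+1) (p : nat) (j : 'I_m.+1) :
  (v *m N ^+ p) 0 j = if (p <= j)%N then v 0 (inord (j - p)) else 0.
Proof.
elim: p j => [|p IH] j.
  by rewrite expr0 mulmx1 subn0 inord_val.
rewrite exprSr mulmxA mulmx_superdiag IH; case: j => -[|j] //= jm.
have jm' : (j < m.+1)%N by exact: ltnW.
by rewrite inordK // ltnS subSS.
Qed.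

Lemma superdiag_nilpotent : N ^+ m.+1 = 0.
Proof.
apply/row_matrixP => i; rewrite row0 rowE; apply/rowP => j.
by rewrite mulmx_superdiagX [RHS]mxE leqNgt ltn_ord.
Qed.

Lemma unipotent_unit : J \is a GRing.unit.
Proof.
suff : J^T \in unitmx by rewrite unitmx_tr.
rewrite unitmxE det_trig.
  by rewrite big1 ?unitr1 // => i _; rewrite !mxE eqxx ltn_eqF // addr0.
apply/is_trig_mxP => i j ij; rewrite !mxE -val_eqE /= gtn_eqF // ltn_eqF ?addr0 //.
by rewrite ltnS ltnW.
Qed.

(** [J] is upper unitriangular, so right multiplication by it preserves the
    first coordinate. *)
Lemma mulmx_unipotentV (v : 'rV[K]_m.+1) : (v *m J^-1) 0 0 = v 0 0.
Proof.
have := congr1 (fun w : 'rV_m.+1 => w 0 0) (mulmxKV unipotent_unit v).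
by rewrite /= mulmxDr mulmx1 mxE mulmx_superdiag /= addr0.
Qed.

Context (alpha : K) (alpha_neq0 : alpha != 0).

Lemma jordan_automorphismK :
  cancel (mulmxr (alpha *: J^-1)) (mulmxr (alpha^-1 *: J) : 'rV[K]_m.+1 -> 'rV[K]_m.+1).
Proof.
move=> v; rewrite /= -mulmxA -scalemxAl -!scalemxAr scalerA divff // scale1r.
by rewrite mulVmx ?mulmx1 //; exact: unipotent_unit.
Qed.

Lemma jordan_automorphismVK :
  cancel (mulmxr (alpha^-1 *: J)) (mulmxr (alpha *: J^-1) : 'rV[K]_m.+1 -> 'rV[K]_m.+1).
Proof.
move=> v; rewrite /= -mulmxA -scalemxAl -!scalemxAr scalerA mulVf // scale1r.
by rewrite mulmxV ?mulmx1 //; exact: unipotent_unit.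
Qed.

Definition jordan_automorphism := Automorphism jordan_automorphismK jordan_automorphismVK.

(** Row vectors, with [t] acting by [alpha J^-1]: this is the action of
    conjugation by [mu] on the upper right block of a triangular
    representation. *)
Definition jordan_module : lmodType (laurent K) := laurent_module jordan_automorphism.

Local Notation s := (laurent_poly ('X - alpha%:P)).

(** [alpha J^-1 - alpha = - alpha (J - 1) J^-1], and [J - 1] commutes with
    [J^-1]. *)
Lemma jordan_module_sX (v : jordan_module) (p : nat) :
  s ^+ p *: v = (v : 'rV[K]_m.+1) *m N ^+ p *m (- alpha *: J^-1) ^+ p.
Proof.
have JU : J \in unitmx := unipotent_unit.
have NJ : GRing.comm N (- alpha *: J^-1).
  rewrite /GRing.comm -scalerAr -scalerAl; congr (_ *: _); apply: commrV.
  by rewrite /GRing.comm mulrDl mulrDr mulr1 mul1r.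
rewrite -mulmxA -[X in _ *m X]/(N ^+ p * _ ^+ p) -exprMn_comm //.
elim: p => [|p IH]; first by rewrite expr0 scale1r mulmx1.
rewrite exprS -scalerA IH [in RHS]exprSr [RHS]mulmxA.
move: (v *m _) => w; rewrite laurent_polyZ.
rewrite poly_actDl -polyCN poly_actC -['X]expr1 poly_actXn /=.
rewrite scaleNr -{2}[w]mulmx1 [X in _ - X]scalemxAr -mulmxBr.
congr (_ *m _).
have JJ : J^-1 + N * J^-1 = 1 by rewrite -{1}[J^-1]mul1r -mulrDl mulrV.
by rewrite -scalerAr scaleNr -(addKr J^-1 (N * J^-1)) JJ scalerDr scalerN opprD opprK.
Qed.

Lemma jordan_module_nilpotent (v : jordan_module) : s ^+ m.+1 *: v = 0.
Proof. by rewrite jordan_module_sX superdiag_nilpotent mulmx0 mul0mx. Qed.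

(** The p-th coordinate of [v N^p] is the first coordinate of [v]. *)
Lemma jordan_module_kernel (v : jordan_module) p :
  s ^+ p *: v = 0 -> (p < m.+1)%N -> (v : 'rV_m.+1) 0 0 = 0.
Proof.
rewrite jordan_module_sX => e pm.
have U : (- alpha *: J^-1) ^+ p \in unitmx.
  apply: (@unitrX 'M[K]_m.+1); rewrite -[_ \is a _]/(_ \in unitmx).
  rewrite unitmxZ ?unitfE ?oppr_eq0 //.
  by rewrite unitmx_inv; exact: unipotent_unit.
have := mulmxK U (v *m N ^+ p); rewrite e mul0mx => /esym/rowP/(_ (Ordinal pm)).
rewrite mulmx_superdiagX /= leqnn subnn mxE => <-.
by congr (v 0 _); apply: val_inj; rewrite /= inordK.
Qed.

Lemma jordan_module_coord (l : laurent K) (v : jordan_module) :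
  (l *: v : 'rV_m.+1) 0 0 = laurent_eval l alpha * (v : 'rV_m.+1) 0 0.
Proof.
have F0 i (w : 'rV[K]_m.+1) : (iter i (mulmxr (alpha *: J^-1)) w) 0 0 = alpha ^+ i * w 0 0.
  elim: i => [|i IH]; first by rewrite mul1r.
  by rewrite iterS /= -scalemxAr mxE mulmx_unipotentV IH mulrA -exprS.
have G0 i (w : 'rV[K]_m.+1) : (iter i (mulmxr (alpha^-1 *: J)) w) 0 0 = w 0 0 / alpha ^+ i.
  elim: i => [|i IH]; first by rewrite divr1.
  rewrite iterS /= -scalemxAr mxE mulmxDr mulmx1 mxE mulmx_superdiag /= addr0 IH.
  by rewrite exprS invfM mulrCA.
rewrite -[(_ *: _ : jordan_module)]/(laurent_act jordan_automorphism l v).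
rewrite /laurent_act /laurent_eval.
move: (laurent_frac l) => [p n] /=; rewrite G0 mulrAC; congr (_ / _).
rewrite /poly_act summxE horner_coef mulr_suml; apply: eq_bigr => i _.
by rewrite mxE F0 mulrA.
Qed.

End JordanModule.

(** * Triangular representations as crossed homomorphisms *)

Section CrossedHomomorphisms.
Context {G : groupType} {K : fieldType} (deg : G -> int) (alpha : K) (m : nat).
Hypothesis degM : forall g h, deg (g * h)%g = deg g + deg h.
Hypothesis alpha_neq0 : alpha != 0.
Local Notation J := (1%:M + superdiag K m.+1 : 'M[K]_m.+1).

(** The upper right block of the identity [rho (g h) = rho g rho h]. *)
Definition crossed_hom (V : G -> 'rV[K]_m.+1) : Prop :=
  forall g h, V (g * h)%g = alpha ^ deg g *: V h + V g *m J ^ deg h.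

(** This is why the first coordinate of a crossed homomorphism is a cocycle. *)
Lemma mulmx_unipotentz (v : 'rV[K]_m.+1) (z : int) : (v *m J ^ z) 0 0 = v 0 0.
Proof.
case: z => k /=.
  elim: k => [|k IH]; first by rewrite -exprnP expr0 mulmx1.
  rewrite -exprnP exprSr mulmxA mulmxDr mulmx1 mxE mulmx_superdiag /= addr0.
  exact: IH.
rewrite -[J ^ _]/(J ^- k.+1) -exprVn.
elim: k.+1 => [|j IH]; first by rewrite expr0 mulmx1.
by rewrite exprSr mulmxA mulmx_unipotentV.
Qed.

Lemma phiE g : phi K deg m.+1 g = J ^ deg g.
Proof. by rewrite /phi /mx_zpow; case: (deg g). Qed.

Lemma crossed_homP (V : 'I_m.+1 -> @cochain1 G K) :
  is_representation (@rho G K deg alpha m.+2 V) <-> crossed_hom (fun g => \row_j V j g).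
Proof.
split=> [rV g h|cV g h].
  have := congr1 ursubmx (rV g h).
  rewrite /rho mulmx_block !block_mxKur mul_scalar_mx phiE => ->.
  by [].
rewrite /rho mulmx_block !mul0mx !mulmx0 !addr0 add0r !phiE; congr block_mx.
- by rewrite degM expfzDr // scalar_mxM.
- by rewrite cV mul_scalar_mx.
- by rewrite degM exprzDr ?unipotent_unit.
Qed.

Lemma CnP (U : @cochain1 G K) : Cn deg alpha m.+2 U <->
  exists2 V, crossed_hom V & forall g, U g = V g 0 0.
Proof.
split=> [[_ [V [V0 /crossed_homP cV]]]|[V cV VU]].
  by exists (fun g => \row_j V j g) => // g; rewrite mxE V0.
have row (g : G) : \row_j (V g 0 j) = V g by apply/rowP => j; rewrite mxE.
split=> [g h|].
  by rewrite !VU cV mxE mulmx_unipotentz mxE addrC.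
exists (fun j g => V g 0 j); split=> [i i0|].
  by apply/funext => g; rewrite VU; congr (V g 0 _); apply: val_inj.
by apply/crossed_homP => g h; rewrite !row cV.
Qed.

Lemma Cn_linear (c : K) (u v : @cochain1 G K) :
  Cn deg alpha m.+2 u -> Cn deg alpha m.+2 v -> Cn deg alpha m.+2 (c *: u + v).
Proof.
move=> /CnP[U cU Uu] /CnP[V cV Vv]; apply/CnP; exists (fun g => c *: U g + V g).
  move=> g h; rewrite cU cV !scalerDr mulmxDl addrACA !scalerA scalemxAl.
  by rewrite [_ * c]mulrC.
by move=> g; rewrite !mxE -Uu -Vv.
Qed.

(** The coboundary of the constant 1. *)
Definition unit_coboundary : @cochain1 G K := fun g => alpha ^ deg g - 1.

Lemma coboundaryE (V : @cochain1 G K) :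
  coboundary1 deg alpha V <-> exists c : K, V = c *: unit_coboundary.
Proof.
split=> -[c Vc]; exists c.
  by apply/funext => g; rewrite Vc mulrC.
by move=> g; rewrite Vc mulrC.
Qed.

(** The full coboundary [alpha^|g| e - e J^|g|] of a row vector [e] with first
    coordinate [c] extends the given cocycle to a crossed homomorphism. *)
Lemma Cn_coboundary (c : K) : Cn deg alpha m.+2 (c *: unit_coboundary).
Proof.
apply/CnP; pose e : 'rV[K]_m.+1 := const_mx c.
exists (fun g => alpha ^ deg g *: e - e *m J ^ deg g) => [g h|g]; last first.
  rewrite -[LHS]/(c * (alpha ^ deg g - 1)) mulrC mulrBl mul1r mxE.
  by congr (_ + _); [rewrite !mxE|rewrite mxE mulmx_unipotentz mxE].
rewrite scalerBr mulmxBl -scalemxAl addrA subrK scalerA degM expfzDr //.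
by rewrite exprzDr ?unipotent_unit // -mulmxA.
Qed.

Lemma cochain_sumE (I : Type) (r : seq I) (P : pred I) (F : I -> @cochain1 G K) g :
  (\sum_(i <- r | P i) F i) g = \sum_(i <- r | P i) F i g.
Proof. by elim/big_rec2: _ => // i x y _ <-. Qed.

End CrossedHomomorphisms.

(** * Crossed homomorphisms and linear maps out of the Alexander module *)

Section AlexanderHoms.
Context {G : groupType} {K : fieldType} (mu : G) (deg : G -> int) (alpha : K) (m : nat).
Hypothesis degP : abelianization_degree mu deg.
Hypothesis alpha_neq0 : alpha != 0.
Local Notation J := (1%:M + superdiag K m.+1 : 'M[K]_m.+1).
Local Notation M := (alexander_module K mu).
Local Notation T := (jordan_module m alpha_neq0).
Local Notation generator g := (pure_tensor (derived_part degP g) 1 : M).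

Let degM g h : deg (g * h)%g = deg g + deg h. Proof. by case: degP. Qed.

Lemma alexander_XZ (u : derived_ab G) (z : K) :
  laurent_poly 'X *: (pure_tensor u z : M) = pure_tensor (derived_ab_conj mu u) z.
Proof.
have [x ->] := derived_ab_class_surj u.
by rewrite derived_ab_conjE; exact: alexander_tE.
Qed.

Lemma jordan_XZ (v : T) : laurent_poly 'X *: v = alpha *: ((v : 'rV[K]_m.+1) *m J^-1).
Proof. by rewrite laurent_polyZ -['X]expr1 poly_actXn /= -scalemxAr. Qed.

Lemma alexander_scalar (u : derived_ab G) (z : K) :
  laurent_poly z%:P *: (pure_tensor u 1 : M) = pure_tensor u z.
Proof. by rewrite laurent_polyZ poly_actC -[in RHS](mulr1 z) [RHS]pure_tensorZ. Qed.

Section FromLinear.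
Variable W : {linear M -> T}.

(** Conjugation by [mu^z] acts on [T] as [(alpha J^-1)^z]. *)
Lemma linear_conj_zpow (z : int) (u : derived_ab G) :
  (W (pure_tensor (derived_ab_conj (zpow mu z) u) 1) : 'rV_m.+1) =
  alpha ^ z *: ((W (pure_tensor u 1) : 'rV_m.+1) *m J ^ (- z)).
Proof.
have JU : J \is a GRing.unit := unipotent_unit m.
have W1 v : (W (pure_tensor (derived_ab_conj mu v) 1) : 'rV_m.+1) =
    alpha *: ((W (pure_tensor v 1) : 'rV_m.+1) *m J^-1).
  by rewrite -alexander_XZ linearZ /= jordan_XZ.
have WV v : (W (pure_tensor (derived_ab_conj mu^-1%g v) 1) : 'rV_m.+1) =
    alpha^-1 *: ((W (pure_tensor v 1) : 'rV_m.+1) *m J).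
  have {2}-> : v = derived_ab_conj mu (derived_ab_conj mu^-1%g v).
    by rewrite -derived_ab_conjM mulgV derived_ab_conj1.
  rewrite W1 -scalemxAl scalerA mulVf // scale1r -mulmxA.
  by rewrite -[_^-1 *m _]/(_^-1 * _) mulVr // mulmx1.
elim/int_rect: z u => [u|z IH u|z IH u].
- by rewrite derived_ab_conj1 oppr0 !expr0z scale1r mulmx1.
- rewrite intS [1 + _]addrC zpow_succ derived_ab_conjM IH W1 -scalemxAl scalerA.
  by rewrite expfzDr // opprD [- z%:Z - 1]addrC exprzDr // -mulmxA.
- rewrite intS [1 + _]addrC opprD zpow_pred derived_ab_conjM IH WV -scalemxAl scalerA.
  by rewrite expfzDr // opprD !opprK [z%:Z + 1]addrC exprzDr // -mulmxA.
Qed.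

(** The crossed homomorphism which is [W] on the derived group and 0 at
    [mu]. *)
Lemma crossed_hom_of_linear :
  crossed_hom deg alpha (fun g => (W (generator g) : 'rV_m.+1) *m J ^ deg g).
Proof.
have JU : J \is a GRing.unit := unipotent_unit m.
have WD x y : (W (x + y) : 'rV[K]_m.+1) = W x + W y by exact: (raddfD W).
move=> g h; rewrite derived_partM pure_tensorDl WD mulmxDl [LHS]addrC.
rewrite linear_conj_zpow degM; congr (_ + _).
  by rewrite -scalemxAl -mulmxA -[X in _ *m X]/(J ^ _ * J ^ _) -exprzDr // addKr.
by rewrite exprzDr // -mulmxA.
Qed.

End FromLinear.

(** On the derived group [V] is additive with values in an abelian group, so it
    factors through the abelianization; there conjugation by [mu] becomes
    multiplication by [alpha J^-1], because [V (mu mu^-1) = 0]. *)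
Lemma linear_of_crossed_hom (V : G -> 'rV[K]_m.+1) : crossed_hom deg alpha V ->
  exists W : {linear M -> T}, forall x : derived_type G,
    W (pure_tensor (derived_ab_class x) 1) = V (derived_val x).
Proof.
move=> cV; have JU : J \is a GRing.unit := unipotent_unit m.
have deg_der x : derived [set: G] x -> deg x = 0 by move=> ?; apply/(deg_eq0P degP).
have VM x y : derived [set: G] x -> derived [set: G] y -> V (x * y)%g = V x + V y.
  by move=> Dx Dy; rewrite cV !deg_der // scale1r mulmx1 addrC.
have V1 : V 1%g = 0.
  have D1 : derived [set: G] 1%g by exact: generated_subgroup1.
  by apply: (addrI (V 1%g)); rewrite -VM // mulg1 addr0.
have VV x : derived [set: G] x -> V x^-1%g = - V x.
  move=> Dx; apply/eqP; rewrite -addr_eq0 -VM ?mulVg ?V1 //.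
  exact: generated_subgroupV.
have V0 x : derived (derived [set: G]) x -> V x = 0.
  have D2 y : derived (derived [set: G]) y -> derived [set: G] y.
    apply: derived_sub; first exact: generated_subgroup1.
      exact: generated_subgroupM.
    exact: generated_subgroupV.
  elim=> {x} [_ [x [y [Dx Dy ->]]]||x y Dx Vx Dy Vy|x Dx Vx] //.
  - rewrite !VM ?VV //; first by rewrite [LHS]addrAC addrK subrr.
    all: do ?[apply: generated_subgroupM|apply: generated_subgroupV]=> //.
  - by rewrite VM ?Vx ?Vy ?addr0 //; exact: D2.
  - by rewrite VV ?Vx ?oppr0 //; exact: D2.
pose w (u : derived_ab G) : 'rV[K]_m.+1 := V (derived_val (repr u)).
have wE x : w (derived_ab_class x) = V (derived_val x).
  apply/eqP; rewrite -subr_eq0 -VV -?VM; try exact: derived_valP.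
    by apply/eqP/V0; exact: derived_ab_repr.
  exact/generated_subgroupV/derived_valP.
have w_add : zmod_morphism w.
  have D u v : w (u + v) = w u + w v.
    have [x ->] := derived_ab_class_surj u; have [y ->] := derived_ab_class_surj v.
    rewrite [X in w X]derived_ab_addE !wE VM //; exact: derived_valP.
  by move=> u v; have := D (u - v) v; rewrite subrK => ->; rewrite addrK.
pose wM := GRing.isZmodMorphism.Build (derived_ab G) 'rV[K]_m.+1 w w_add.
pose wa : {additive derived_ab G -> 'rV[K]_m.+1} := HB.pack w wM.
have [h hE] := tensorZ_lift_exists wa.
have wC u : w (derived_ab_conj mu u) = alpha *: (w u *m J^-1).
  have [x ->] := derived_ab_class_surj u; rewrite derived_ab_conjE !wE /=.
  have deg_mu : deg mu = 1 by case: degP.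
  have deg_x : deg (derived_val x) = 0 by exact/deg_der/derived_valP.
  have : V (mu * mu^-1)%g = 0 by rewrite mulgV.
  rewrite !cV degM deg_x (degV degP) deg_mu addr0 mulmx1 mulmxDl addrCA => ->.
  by rewrite addr0 -scalemxAl.
have hfg v : h (aut_fun (alexander_automorphism K mu) v) =
    aut_fun (jordan_automorphism m alpha_neq0) (h v).
  elim/tensorZ_ind: v => [a z|u v IHu IHv]; last first.
    transitivity (h (aut_fun (alexander_automorphism K mu) u) +
      h (aut_fun (alexander_automorphism K mu) v)); first by rewrite !raddfD.
    by rewrite IHu IHv !raddfD.
  rewrite [X in h X](tensorZ_map_pure (derived_ab_conj mu : {additive _ -> _})) !hE.
  by rewrite [LHS]/= -[LHS]/(z *: w _) wC /= -scalemxAr -scalemxAl scalerA mulrC -scalerA.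
have [W WE] := laurent_linear_exists hfg.
by exists W => x; rewrite WE hE scale1r [LHS]wE.
Qed.

Lemma alexander_divisible (x : M) : exists z, x = laurent_poly ('X - 1%:P) *: z.
Proof.
elim/tensorZ_ind: x => [a z|u v [x ->] [y ->]]; last by exists (x + y); rewrite scalerDr.
have [v ->] := conj_diff_surj degP a; exists (pure_tensor v z).
by rewrite rmorphB /= scalerBl rmorph1 scale1r alexander_XZ pure_tensorBl.
Qed.

End AlexanderHoms.

(** * A basis of the coboundaries and the liftable cocycles *)

Section Core.
Context {G : groupType} {K : fieldType} (mu : G) (deg : G -> int).
Hypothesis degP : abelianization_degree mu deg.
Local Notation M := (alexander_module K mu).

Let degM g h : deg (g * h)%g = deg g + deg h. Proof. by case: degP. Qed.

(** The element [d] given by the determinant trick annihilates [M] and has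
    value 1 at [t = 1].  Hence [d] is nonzero, and so is the value at 1 of the
    generator [Delta], of which [d] is a multiple. *)
Lemma alexander_torsion (Delta : laurent K) : generates_order_ideal M Delta ->
  laurent_eval Delta 1 != 0 /\
  exists2 p : {poly K}, p != 0 & forall x : M, laurent_poly p *: x = 0.
Proof.
move=> [r [l [P [g [presP idealE]]]]].
have [d [d_ideal dM d1]] :=
  divisible_presented_module presP (@alexander_divisible _ K _ _ degP).
have [ev evE] := laurent_eval_exists (oner_neq0 K).
have {}d1 : ev d = 1.
  by apply: d1; rewrite evE laurent_eval_poly ?oner_neq0 // !hornerE subrr.
split.
  move: d_ideal; rewrite idealE => -[a dE]; rewrite -evE.
  by apply: contra_eq_neq d1 => D0; rewrite dE rmorphM D0 mulr0 eq_sym oner_neq0.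
(* clear the denominator of d *)
have [p [n pE]] := laurent_clear_denominator d; exists p.
  apply/eqP => p0; have := congr1 ev pE.
  rewrite p0 rmorphM d1 rmorph0 rmorph0 mul1r.
  rewrite evE laurent_eval_poly ?oner_neq0 // hornerXn expr1n.
  by apply/eqP; rewrite oner_neq0.
by move=> x; rewrite -pE mulrC -scalerA dM scaler0.
Qed.

Context (alpha : K) (alpha_neq0 : alpha != 0) (m : nat).

(** On the infinite cyclic group generated by [mu] every cocycle is a
    coboundary, since [alpha - 1] is invertible. *)
Lemma crossed_hom_zpow (V : G -> 'rV[K]_m.+1) z :
  alpha != 1 -> crossed_hom deg alpha V ->
  V (zpow mu z) 0 0 = (alpha ^ z - 1) * (V mu 0 0 / (alpha - 1)).
Proof.
move=> a1 cV; have a10 : alpha - 1 != 0 by rewrite subr_eq0.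
pose v z := V (zpow mu z) 0 0; rewrite -/(v z).
have vS z' : v (z' + 1) = alpha ^ z' * V mu 0 0 + v z'.
  by rewrite /v zpow_succ cV mxE mulmx_unipotentz mxE (deg_zpow degP).
have rS z' : (alpha ^ (z' + 1) - 1) * (V mu 0 0 / (alpha - 1)) =
    alpha ^ z' * V mu 0 0 + (alpha ^ z' - 1) * (V mu 0 0 / (alpha - 1)).
  by rewrite expfzDr //; field.
elim/int_rect: z => [|z IH|z IH].
- rewrite expr0z subrr mul0r; have := cV 1%g 1%g.
  rewrite mulg1 (deg1 degP) expr0z expr0z mulmx1 scale1r => /eqP.
  by rewrite -subr_eq0 opprD addrA subrr sub0r oppr_eq0 => /eqP V1; rewrite /v /= V1 mxE.
- by rewrite intS addrC vS IH rS.
- have e : - z%:Z = - z.+1%:Z + 1 by rewrite intS opprD addrAC addNr add0r.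
  by move: IH; rewrite e vS rS => /addrI.
Qed.

Context (k : nat) (q : 'I_k -> nat) (q_gt0 : forall i, (0 < q i)%N).
Hypothesis tau_iso : iso_direct_sum
  (primary_part M (laurent_poly ('X - alpha%:P)))
  (fun i => cyclic_module (laurent_poly ('X - alpha%:P) ^+ q i)).
Context (Delta : laurent K).
Hypothesis Delta_alexander : generates_order_ideal M Delta.
Hypothesis alpha_root : laurent_eval Delta alpha = 0.
Local Notation S := [pred i : 'I_k | (m.+1 <= q i)%N].

Lemma alexander_root_neq1 : alpha != 1.
Proof.
have [D1 _] := alexander_torsion Delta_alexander.
by apply: contraNneq D1 => <-; rewrite alpha_root.
Qed.

(** The cocycle [U i] is the functional [f i] of [liftable_functionals] on the
    derived group, extended by 0 at [mu].  A member of [Cn] is the sum of a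
    coboundary, which accounts for its value at [mu], and of a functional on
    the Alexander module. *)
Lemma Cn_basis : exists U : 'I_k -> @cochain1 G K,
  [/\ forall i, i \in S -> Cn deg alpha m.+2 (U i),
      forall i, i \in S -> U i mu = 0,
      forall V, Cn deg alpha m.+2 V -> exists (c : K) (a : 'I_k -> K),
        V = c *: unit_coboundary deg alpha + \sum_(i in S) a i *: U i
    & forall a : 'I_k -> K,
        (forall x : derived_type G, \sum_(i in S) a i * U i (derived_val x) = 0) ->
        forall i, i \in S -> a i = 0].
Proof.
have [_ [p p0 pM]] := alexander_torsion Delta_alexander.
have [a aM] := primary_projection alpha m.+1 p0 pM.
have [ev evE] := laurent_eval_exists alpha_neq0.
pose T := jordan_module m alpha_neq0.
pose eps (v : T) : K := (v : 'rV[K]_m.+1) 0 0.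
have ev_s : ev (laurent_poly ('X - alpha%:P)) = 0.
  by rewrite evE laurent_eval_poly // !hornerE subrr.
have epsD : {morph eps : u v / u + v} by move=> u v; rewrite /eps mxE.
have epsZ l v : eps (l *: v) = ev l * eps v by rewrite evE; exact: jordan_module_coord.
pose v0 : T := const_mx 1 : 'rV[K]_m.+1.
have eps_v0 : eps v0 = 1 by rewrite /eps mxE.
have [b [f [fb f_lift f_span f_small]]] :=
  liftable_functionals ev_s epsD epsZ eps_v0
  (@jordan_module_nilpotent _ _ _ alpha_neq0)
  (fun v p => @jordan_module_kernel _ _ _ alpha_neq0 v p) (ltn0Sn m) q_gt0 tau_iso aM.
pose gen g : M := pure_tensor (derived_part degP g) 1.
have f_lin i : i \in S -> [/\ f i 0 = 0, {morph f i : x y / x + y} &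
    forall l x, f i (l *: x) = ev l * f i x].
  move=> /f_lift[W fW]; have WE x y l : W (l *: x + y) = l *: W x + W y by exact: linearP.
  split=> [|x y|l x]; rewrite !fW.
  - by rewrite linear0 /eps mxE.
  - by rewrite [W _]raddfD epsD.
  - by rewrite [W _]linearZ epsZ.
exists (fun i g => f i (gen g)); split.
- move=> i /f_lift[W fW]; apply/(CnP m degM alpha_neq0).
  exists (fun g => (W (gen g) : 'rV_m.+1) *m
    (1%:M + superdiag K m.+1 : 'M[K]_m.+1) ^ deg g).
    exact: crossed_hom_of_linear.
  by move=> g; rewrite mulmx_unipotentz fW.
- move=> i iS; have [f0 _ _] := f_lin i iS.
  by rewrite /gen derived_part_mu pure_tensor0l f0.
- move=> U /(CnP m degM alpha_neq0)[V cV UV].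
  have [W WV] := linear_of_crossed_hom degP alpha_neq0 cV.
  exists (V mu 0 0 / (alpha - 1)), (fun i => eps (W (b i))).
  apply/funext => g.
  have -> : U g = V (g * zpow mu (- deg g))%g 0 0 + V (zpow mu (deg g)) 0 0.
    rewrite UV -{1}[g](mulgVK (zpow mu (deg g))) -zpowN cV degM.
    rewrite (deg_zpow degP) subrr expr0z scale1r.
    by rewrite mxE mulmx_unipotentz addrC.
  rewrite crossed_hom_zpow ?alexander_root_neq1 // addrC mulrC.
  have -> : V (g * zpow mu (- deg g))%g 0 0 = eps (W (gen g)).
    by rewrite /eps WV.
  (* the summands with q i < m.+1 vanish *)
  rewrite f_span (bigID (fun i => i \in S)) /= [X in _ + (_ + X)]big1 ?addr0; last first.
    by move=> i; rewrite inE -ltnNge => qi; rewrite f_small // mulr0.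
  congr (_ + _); rewrite cochain_sumE; apply: eq_bigr => i _.
  by rewrite -[RHS]/(eps (W (b i)) * f i (gen g)) mulrC.
- move=> c c0 j jS.
  pose h (x : M) := \sum_(i in S) c i * f i x.
  have h0 x : h x = 0.
    elim/tensorZ_ind: x => [u z|u v hu hv].
      have [x ->] := derived_ab_class_surj u; rewrite -alexander_scalar.
      have -> : h (laurent_poly z%:P *: (pure_tensor (derived_ab_class x) 1 : M)) =
          z * h (pure_tensor (derived_ab_class x) 1).
        rewrite /h mulr_sumr; apply: eq_bigr => i iS; have [_ _ ->] := f_lin i iS.
        by rewrite evE laurent_eval_poly // hornerC mulrCA.
      have := c0 x; rewrite /gen derived_part_derived -/(h _) => ->.
      by rewrite mulr0.
    rewrite -[RHS](addr0 0) -{1}hu -hv /h -big_split; apply: eq_bigr => i iS.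
    by have [_ -> _] := f_lin i iS; rewrite mulrDr.
  have := h0 (b j); rewrite /h (bigD1 j) //= fb eqxx mulr1.
  rewrite big1 ?addr0 // => i /andP[_ ij].
  by rewrite fb (negbTE ij) mulr0.
Qed.

End Core.

(** * The dimension count *)

Section Main.
Context {G : groupType} {K : fieldType} (mu : G) (deg : G -> int).
Hypothesis degP : abelianization_degree mu deg.
Context (Delta : laurent K) (alpha : K) (alpha_neq0 : alpha != 0).
Hypothesis Delta_alexander : generates_order_ideal (alexander_module K mu) Delta.
Hypothesis alpha_root : laurent_eval Delta alpha = 0.
Context (m k : nat) (q : 'I_k -> nat) (q_gt0 : forall i, (0 < q i)%N).
Hypothesis tau_iso : iso_direct_sum
  (primary_part (alexander_module K mu) (laurent_poly ('X - alpha%:P)))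
  (fun i => cyclic_module (laurent_poly ('X - alpha%:P) ^+ q i)).
Local Notation S := [pred i : 'I_k | (m.+1 <= q i)%N].
Local Notation cob := (unit_coboundary deg alpha).

Let degM g h : deg (g * h)%g = deg g + deg h. Proof. by case: degP. Qed.
Let deg_mu : deg mu = 1. Proof. by case: degP. Qed.

(** A relation between the coboundary and the [U i] is evaluated first at
    [mu], where every [U i] vanishes and the coboundary is [alpha - 1], and
    then on the derived group, where the coboundary vanishes. *)
Lemma Cn_dimension : has_dimension (Cn deg alpha m.+2) (1 + #|S|).
Proof.
have a1 := alexander_root_neq1 degP Delta_alexander alpha_root.
have [U [U_Cn U_mu U_span U_free]] :=
  Cn_basis degP alpha_neq0 m q_gt0 tau_iso Delta_alexander alpha_root.
pose e (t : 'I_(1 + #|S|)) : @cochain1 G K :=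
  match fintype.split t with inl _ => cob | inr j => U (enum_val j) end.
have eE (a : 'I_(1 + #|S|) -> K) : \sum_t a t *: e t =
    a (lshift _ ord0) *: cob +
    \sum_(j < #|S|) a (rshift 1 j) *: U (enum_val j).
  rewrite big_split_ord big_ord1 /e; congr (_ + _).
    by rewrite (unsplitK (inl ord0)).
  by apply: eq_bigr => j _; rewrite (unsplitK (inr j)).
exists e; split=> [V|a].
  split=> [/U_span[c [a ->]]|[a ->]].
    exists (fun t => match fintype.split t with inl _ => c | inr j => a (enum_val j) end).
    rewrite eE (unsplitK (inl ord0)) big_enum_val; congr (_ + _).
    by apply: eq_bigr => j _; rewrite (unsplitK (inr j)).
  have Cn0 : Cn deg alpha m.+2 (0 : @cochain1 G K).
    by rewrite -(scale0r cob); exact: Cn_coboundary.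
  rewrite eE; apply: Cn_linear => //.
    by rewrite -[cob](scale1r cob); exact: Cn_coboundary.
  elim/big_rec: _ => // j V' _ CV.
  by apply: Cn_linear => //; apply: U_Cn; exact: enum_valP.
rewrite eE => a0.
have {}a0 g : a (lshift _ ord0) * (alpha ^ deg g - 1) +
    \sum_(j < #|S|) a (rshift 1 j) * U (enum_val j) g = 0.
  have := congr1 (fun V : @cochain1 G K => V g) a0.
  by rewrite -[X in X = _ -> _]/(_ g + _ g) cochain_sumE.
have c0 : a (lshift _ ord0) = 0.
  have := a0 mu; rewrite deg_mu big1 => [|j _]; last by rewrite U_mu ?mulr0 ?enum_valP.
  by rewrite addr0 => /eqP; rewrite mulf_eq0 subr_eq0 (negbTE a1) orbF => /eqP.
have r0 j : a (rshift 1 j) = 0.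
  (* transport the coefficients from the numbering of S to S itself *)
  pose a' i := if [pick j | enum_val j == i] is Some j then a (rshift 1 j) else 0.
  have a'E j' : a' (enum_val j') = a (rshift 1 j').
    rewrite /a'; case: pickP => [j'' /eqP/enum_val_inj -> //|/(_ j')].
    by rewrite eqxx.
  rewrite -a'E; apply: U_free; last exact: enum_valP.
  move=> x; rewrite big_enum_val; have := a0 (derived_val x).
  rewrite c0 mul0r add0r => e0; rewrite -[RHS]e0; apply: eq_bigr => i _.
  by rewrite a'E.
move=> t; case: (split_ordP t) => j ->; last exact: r0.
by rewrite ord1.
Qed.

Lemma coboundary_proper :
  coboundary1 deg alpha `<` Cn deg alpha m.+2 <-> exists i : 'I_k, (m.+1 <= q i)%N.
Proof.
have a1 := alexander_root_neq1 degP Delta_alexander alpha_root.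
have [U [U_Cn U_mu U_span U_free]] :=
  Cn_basis degP alpha_neq0 m q_gt0 tau_iso Delta_alexander alpha_root.
split=> [[_ nsub]|[i iS]].
  apply: contrapT => nS; apply: nsub => V /U_span[c [a ->]].
  rewrite big_pred0 => [|i]; last first.
    by apply/negP => iS; apply: nS; exists i.
  by apply/coboundaryE; exists c; rewrite addr0.
split=> [V /coboundaryE[c ->]|sub]; first exact: Cn_coboundary.
have [c Uc] := sub _ (U_Cn i iS).
have /eqP := oner_neq0 K; apply.
have := U_free (fun j => (j == i)%:R) _ i iS; rewrite eqxx; apply => x.
rewrite big1 // => j _; case: eqP => [->|_]; last by rewrite mul0r.
by rewrite Uc (iffRL (deg_eq0P degP _) (derived_valP x)) expr0z subrr mul0r mulr0.
Qed.

End Main.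

Theorem mainTheorem1 (R : realType)
    (K : set 'rV[R]_4) (tube : (R * R) * (R * R) -> 'rV[R]_4)
    (K_knot : is_knot K) (K_tube : is_tubular_embedding K tube)
    (x0 : exterior tube) (mu : fundamental_group x0)
    (mu_meridian : is_meridian mu)
    (deg : fundamental_group x0 -> int)
    (deg_ab : abelianization_degree mu deg)
    (Delta : laurent R[i])
    (Delta_alexander : generates_order_ideal (alexander_module R[i] mu) Delta)
    (alpha : R[i]) (alpha_neq0 : alpha != 0)
    (alpha_root : laurent_eval Delta alpha = 0)
    (k : nat) (q : 'I_k -> nat) (q_gt0 : forall i, (0 < q i)%N)
    (tau_alpha_iso : iso_direct_sum
       (primary_part (alexander_module R[i] mu)
          (laurent_poly ('X - alpha%:P)))
       (fun i => cyclic_module (laurent_poly ('X - alpha%:P) ^+ q i)))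
    (n : nat) (n_ge2 : (2 <= n)%N) :
  (coboundary1 deg alpha `<` Cn deg alpha n <->
     exists i : 'I_k, (n - 1 <= q i)%N) /\
  has_dimension (Cn deg alpha n) (1 + #|[pred i : 'I_k | (n - 1 <= q i)%N]|).
Proof.
case: n n_ge2 => [|[|m]] // _; rewrite subn1; split.
- exact: (coboundary_proper deg_ab alpha_neq0 Delta_alexander alpha_root m
    q_gt0 tau_alpha_iso).
- exact: (Cn_dimension deg_ab alpha_neq0 Delta_alexander alpha_root m
    q_gt0 tau_alpha_iso).
Qed.
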